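(* Let $d\ge 2$. For every $u\in(0,\infty)$, the Poisson cylinder model of intensity $u$ in $\mathbb{H}^d$ satisfies $$\mathbb{P}[\operatorname{diam}(\mathcal{C})=\infty]=1.$$
   Context: $\mathbb{H}^d$ is $d$-dimensional hyperbolic space (curvature $-1$), with metric $d_H$ and a fixed origin $o$; $B(x,r)$ is the closed hyperbolic ball. $A(d,1)$ is the set of all bi-infinite geodesics (lines) in $\mathbb{H}^d$. For $K\subset\mathbb{H}^d$ let $\mathcal{L}_K=\{L\in A(d,1): L\cap K\neq\emptyset\}$. $\mu_{d,1}$ is the unique measure on $A(d,1)$ invariant under isometries of $\mathbb{H}^d$ and normalized by $\mu_{d,1}(\mathcal{L}_{B(o,1)})=O_{d-1}$, where $O_{d-1}$ is the $(d-1)$-dimensional volume of the Euclidean unit sphere $\mathbb{S}^{d-1}$. For $u>0$, $\omega$ is a Poisson point process on $A(d,1)$ with intensity measure $u\mu_{d,1}$. For a line $L$, $\mathfrak{c}(L)=\{x\in\mathbb{H}^d: d_H(x,L)\le 1\}$; we write $\mathfrak{c}\in\omega$ to mean $\mathfrak{c}=\mathfrak{c}(L)$ for some point $L$ of $\omega$. The occupied set is $\mathcal{C}=\bigcup_{L\in\omega}\mathfrak{c}(L)$. For two cylinders $\mathfrak{c}_a,\mathfrak{c}_b\in\omega$, $\operatorname{Cdist}(\mathfrak{c}_a,\mathfrak{c}_b)$ is the minimal number $k$ of cylinders $\mathfrak{c}_1,\dots,\mathfrak{c}_k\in\omega$ such that $\mathfrak{c}_a\cup\mathfrak{c}_b\cup\bigcup_{i=1}^k\mathfrak{c}_i$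 is a connected set, and $\operatorname{Cdist}(\mathfrak{c}_a,\mathfrak{c}_b)=\infty$ if no such finite collection exists. Then $\operatorname{diam}(\mathcal{C})=\sup\{\operatorname{Cdist}(\mathfrak{c}_a,\mathfrak{c}_b): \mathfrak{c}_a,\mathfrak{c}_b\in\omega\}$. *)

(* Defs.v *)
From HB Require Import structures.
From mathcomp Require Import all_boot all_order all_algebra.
From mathcomp Require Import all_classical all_reals all_analysis.
From mathcomp Require Import measurable_realfun.
From mathcomp Require Import ring lra.

Set Implicit Arguments.
Unset Strict Implicit.
Unset Printing Implicit Defensive.
Import Order.TTheory GRing.Theory Num.Theory.
Import numFieldNormedType.Exports.

Local Open Scope classical_set_scope.
Local Open Scope ring_scope.

(** * Hyperbolic space

    The hyperboloid model of the space of dimension [n] and curvature -1: the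
    upper sheet of [<x, x> = -1] in R^(n+1), with distance arcosh (- <x, y>). *)

Definition minkowski (R : realType) (n : nat) (x y : 'rV[R]_n.+1) : R :=
  \sum_(i < n) x 0 (lift ord0 i) * y 0 (lift ord0 i) - x 0 ord0 * y 0 ord0.

Record hyp (R : realType) (n : nat) := Hyp {
  hcoord : 'rV[R]_n.+1 ;
  hcoordP : (minkowski hcoord hcoord == -1) && (0 < hcoord 0 ord0) }.

HB.instance Definition _ R n := [isSub for @hcoord R n].
HB.instance Definition _ R n := [Choice of hyp R n by <:].

(** The subspace topology, which is also the topology of the distance [dH]. *)
HB.instance Definition _ R n :=
  Topological.copy (hyp R n) (initial_topology (@hcoord R n)).

Definition arcosh (R : realType) (t : R) : R := ln (t + Num.sqrt (t ^+ 2 - 1)).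

Definition dH (R : realType) (n : nat) (x y : hyp R n) : R :=
  arcosh (- minkowski (hcoord x) (hcoord y)).

Definition hball (R : realType) (n : nat) (x : hyp R n) (r : R) :
    set (hyp R n) :=
  [set y | dH x y <= r].

Definition dH_set (R : realType) (n : nat) (x : hyp R n) (A : set (hyp R n)) :
    R :=
  inf [set dH x y | y in A].

Definition hyp_isometry (R : realType) (n : nat) (g : hyp R n -> hyp R n) :
    Prop :=
  bijective g /\ forall x y, dH (g x) (g y) = dH x y.

(** * Lines *)

Definition is_line (R : realType) (n : nat) (L : set (hyp R n)) : Prop :=
  exists2 c : R -> hyp R n,
    (forall s t, dH (c s) (c t) = `|s - t|) & L = range c.

Record line (R : realType) (n : nat) := Line {
  line_set :> set (hyp R n) ;
  line_setP : is_line line_set }.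

HB.instance Definition _ R n := gen_eqMixin (line R n).
HB.instance Definition _ R n := gen_choiceMixin (line R n).

Section line_exists.
Variables (R : realType) (n : nat).

Let ch (t : R) : R := (expR t + expR (- t)) / 2.
Let sh (t : R) : R := (expR t - expR (- t)) / 2.

Let expRM1 (t : R) : expR t * expR (- t) = 1.
Proof. by rewrite -expRD subrr expR0. Qed.

Let axis (t : R) : 'rV[R]_n.+2 :=
  \row_(j < n.+2) (if j == ord0 then ch t
                   else if j == lift ord0 ord0 then sh t else 0).

Let minkowski_axis s t : minkowski (axis s) (axis t) = - ch (s - t).
Proof.
rewrite /minkowski big_ord_recl big1 ?addr0; last first.
  by move=> i _; rewrite !mxE /= mul0r.
rewrite !mxE /= /ch /sh opprB !expRD; field => //.
Qed.

Let axisP t : (minkowski (axis t) (axis t) == -1) && (0 < axis t 0 ord0).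
Proof.
rewrite minkowski_axis !mxE /ch subrr oppr0 expR0 /= divr_gt0 ?addr_gt0 ?expR_gt0//.
by rewrite andbT; apply/eqP; field.
Qed.

Let arcosh_ch t : arcosh (ch t) = `|t|.
Proof.
have arcosh_ge0 x : 0 <= x -> arcosh (ch x) = x.
  move=> x0; rewrite /arcosh.
  have -> : ch x ^+ 2 - 1 = sh x ^+ 2.
    have h := expRM1 x.
    by rewrite -h /ch /sh; field.
  rewrite sqrtr_sqr ger0_norm; last first.
    by rewrite /sh divr_ge0// subr_ge0 ler_expR; lra.
  have -> : ch x + sh x = expR x by rewrite /ch /sh; field.
  by rewrite expRK.
have [t0|t0] := leP 0 t; first by rewrite arcosh_ge0 ?ger0_norm.
have -> : ch t = ch (- t) by rewrite /ch opprK addrC.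
by rewrite arcosh_ge0 ?ltr0_norm// oppr_ge0 ltW.
Qed.

Lemma line_exists : exists L : set (hyp R n.+1), is_line L.
Proof.
exists (range (fun t => Hyp (axisP t))), (fun t => Hyp (axisP t)) => // s t.
by rewrite /dH /= minkowski_axis opprK arcosh_ch.
Qed.

End line_exists.

(** Pointedness, required by [measurableType], is why lines are measured only
    in positive dimension: there is no line in dimension 0. *)
HB.instance Definition _ R n :=
  isPointed.Build (line R n.+1) (Line (projT2 (cid (@line_exists R n)))).

(** The set of lines written L_K in the literature. *)
Definition hitting (R : realType) (n : nat) (K : set (hyp R n)) :
    set (line R n) :=
  [set L : line R n | L `&` K !=set0].

(** The Borel sigma-algebra of the space of lines, generated by the sets of
    lines hitting a compact set. *)
Definition hitting_sets (R : realType) (n : nat) : set (set (line R n)) :=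
  [set hitting K | K in [set K | compact K]].

HB.instance Definition _ R n := Measurable.copy (line R n.+1)
  (g_sigma_algebraType (@hitting_sets R n.+1)).

Definition line_image (R : realType) (n : nat) (g : hyp R n -> hyp R n)
    (A : set (line R n)) : set (line R n) :=
  [set L : line R n | exists2 L' : line R n, A L' & line_set L = g @` L'].

(** Volume of the Euclidean unit sphere of dimension [n], that is,
    2 pi^((n+1)/2) / Gamma((n+1)/2). *)
Fixpoint sphere_volume (R : realType) (n : nat) : R :=
  match n with
  | 0 => 2
  | 1 => 2 * pi
  | m.+2 => 2 * pi / m.+1%:R * sphere_volume R m
  end.

(** The defining properties of the invariant measure on lines; the choice of
    the origin [o] is immaterial by invariance. *)
Definition invariant_line_measure (R : realType) (n : nat) (o : hyp R n.+1)
    (mu : {measure set (line R n.+1) -> \bar R}) : Prop :=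
  (forall (g : hyp R n.+1 -> hyp R n.+1) (A : set (line R n.+1)),
     hyp_isometry g -> measurable A -> mu (line_image g A) = mu A) /\
  mu (hitting (hball o 1)) = (sphere_volume R n)%:E.

(** * Poisson point processes

    A point measure, a sum of Dirac masses, is encoded by its multiplicity
    function [w : E -> nat]; its points are the [x] with [w x != 0]. *)

Definition pcount (R : realType) (E : choiceType) (w : E -> nat) (A : set E) :
    \bar R :=
  \esum_(x in A) (w x)%:R%:E.

(** Subfamilies are covered by taking [C i := setT]. *)
Definition mutually_independent (R : realType) dT (T : measurableType dT)
    (P : probability T R) (k : nat) (X : 'I_k -> T -> \bar R) : Prop :=
  forall C : 'I_k -> set (\bar R), (forall i, measurable (C i)) ->
    P (\bigcap_i (X i @^-1` C i)) = (\prod_(i < k) P (X i @^-1` C i))%E.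

(** The library's [poisson_pmf] is not the Dirac mass at 0 for the rate 0,
    hence the explicit formula. *)
Definition poisson_process (R : realType) dE (E : measurableType dE)
    dT (T : measurableType dT) (P : probability T R)
    (Lambda : {measure set E -> \bar R}) (X : T -> E -> nat) : Prop :=
  [/\ forall B, measurable B ->
        measurable_fun [set: T] (fun t => pcount R (X t) B),
      forall B, measurable B -> (Lambda B < +oo)%E -> forall k : nat,
        P [set t | pcount R (X t) B = k%:R%:E] =
        (expR (- fine (Lambda B)) * fine (Lambda B) ^+ k / k`!%:R)%:E,
      forall B, measurable B -> Lambda B = +oo%E ->
        P [set t | pcount R (X t) B = +oo%E] = 1%E
    & forall (k : nat) (B : 'I_k -> set E), (forall i, measurable (B i)) ->
        trivIset [set: 'I_k] B ->
        mutually_independent P (fun i t => pcount R (X t) (B i))].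

Definition locally_finite (R : realType) (n : nat) (w : line R n -> nat) :
    Prop :=
  forall K : set (hyp R n), compact K -> (pcount R w (hitting K) < +oo)%E.

Definition poisson_line_process (R : realType) (n : nat)
    dT (T : measurableType dT) (P : probability T R)
    (Lambda : {measure set (line R n.+1) -> \bar R})
    (X : T -> line R n.+1 -> nat) : Prop :=
  (forall t, locally_finite (X t)) /\ poisson_process P Lambda X.

(** * Cylinders *)

Definition cylinder (R : realType) (n : nat) (L : line R n) : set (hyp R n) :=
  [set x | dH_set x L <= 1].

Definition cylinders (R : realType) (n : nat) (w : line R n -> nat) :
    set (set (hyp R n)) :=
  [set cylinder L | L in [set L | w L != 0%N]].

(** [ereal_inf set0 = +oo]. *)
Definition Cdist (R : realType) (n : nat) (w : line R n -> nat)
    (ca cb : set (hyp R n)) : \bar R :=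
  ereal_inf [set k%:R%:E | k in [set k : nat |
    exists2 c : 'I_k -> set (hyp R n), (forall i, cylinders w (c i)) &
      connected (ca `|` cb `|` \bigcup_i c i)]].

(** The diameter of the occupied set, through the cylinders that form it. *)
Definition diam (R : realType) (n : nat) (w : line R n -> nat) : \bar R :=
  ereal_sup [set Cdist w ca cb | ca in cylinders w & cb in cylinders w].

(* Main.v *)
(** Two cylinders whose lines hit the balls of radius rho about o and x are at
    Cdist greater than k as soon as no chain of at most k+2 distinct cylinders
    leads from one ball to the other.  For rho large both balls are hit with
    probability close to 1, uniformly in x, so it suffices that the probability
    of such a chain tends to 0 as x goes to infinity.

    The places where consecutive cylinders of a chain touch are rounded to a
    net N of the hyperbolic space, which turns the chain into distinct points
    of the process in the sets E(y, z_1), E(z_1, z_2), ..., E(z_m, x), where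
    E(y, z) is the set of lines hitting the balls of radius rho about y and z.
    By independence this has probability at most the product of the intensities
    of these sets.  To sum over the z_i in N one only needs, for 0 < a <= 1,

      sum_(z in N) mu(E(y, z)) exp(- a d(x, z)) <= C exp(- (a / 4) d(x, y)),

    applied m times.  It follows from two facts: a line meets at most about
    4 r net balls whose centres are within r of x, and
    mu(hit B(y, rho) and B(x, s)) <= C exp(2 s - d(x, y)).  For the latter,
    invariance lets x range over exponentially many points of the sphere about
    y, so well separated that a line through B(y, rho) comes near at most two
    of them. *)

From mathcomp Require Import all_boot all_order all_algebra.
From mathcomp Require Import all_classical all_reals all_analysis.
From mathcomp Require Import measurable_realfun.
From mathcomp Require Import ring lra.
Require Import Defs.

Set Implicit Arguments.
Unset Strict Implicit.
Unset Printing Implicit Defensive.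
Import Order.TTheory GRing.Theory Num.Theory.
Import numFieldNormedType.Exports.
Local Open Scope classical_set_scope.
Local Open Scope ring_scope.

(** * The hyperboloid model *)

Section hyperbolic_cosine.
Variable R : realType.

Definition ch (t : R) : R := (expR t + expR (- t)) / 2.

Lemma ch_ge1 t : 1 <= ch t.
Proof.
rewrite /ch expRN; have := expR_gt0 t; set a := expR t => a0.
rewrite ler_pdivlMr// mul1r -subr_ge0.
have -> : a + a^-1 - 2 = (a - 1) ^+ 2 / a by field; rewrite gt_eqF.
by rewrite divr_ge0 ?sqr_ge0// ltW.
Qed.

Lemma ch_arcosh A : 1 <= A -> ch (arcosh A) = A.
Proof.
move=> A1; rewrite /ch expRN /arcosh.
set s := Num.sqrt _.
have s0 : 0 <= s by apply: sqrtr_ge0.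
have s2 : s ^+ 2 = A ^+ 2 - 1 by rewrite sqr_sqrtr//; nra.
have As : 0 < A + s by lra.
rewrite lnK ?posrE//.
have -> : (A + s)^-1 = A - s.
  apply: (mulfI (lt0r_neq0 As)); rewrite mulfV ?lt0r_neq0//; nra.
by field.
Qed.

Lemma ltr_ch (s t : R) : 0 <= s -> s < t -> ch s < ch t.
Proof.
move=> s0 st; rewrite /ch !expRN ltr_pM2r ?invr_gt0//.
have a1 : 1 <= expR s by rewrite -expR0 ler_expR.
have ab : expR s < expR t by rewrite ltr_expR.
move: a1 ab; set a := expR s; set b := expR t => a1 ab.
have a0 : 0 < a by lra.
have b0 : 0 < b by lra.
rewrite -subr_gt0.
have -> : b + b^-1 - (a + a^-1) = (b - a) * (a * b - 1) / (a * b).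
  by field; rewrite !gt_eqF.
apply: divr_gt0; last exact: mulr_gt0.
by apply: mulr_gt0; nra.
Qed.

Lemma ler_ch (s t : R) : 0 <= s -> 0 <= t -> (ch s <= ch t) = (s <= t).
Proof.
move=> s0 t0; have [st|ts] := leP s t.
  move: st; rewrite le_eqVlt => /orP[/eqP->|st]; first by rewrite lexx.
  by rewrite ltW// ltr_ch.
by apply/negbTE; rewrite -ltNge ltr_ch.
Qed.

Lemma arcosh_ge0 (A : R) : 1 <= A -> 0 <= arcosh A.
Proof.
move=> A1; rewrite /arcosh ln_ge0//.
by apply: (le_trans A1); rewrite lerDl sqrtr_ge0.
Qed.

(** The square root is sinh a sinh b, written through [ch] because Cauchy-Schwarz delivers this form
    in [dH_triangle]. *)
Lemma chD (a b : R) : 0 <= a -> 0 <= b ->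
  ch (a + b) = ch a * ch b + Num.sqrt ((ch a ^+ 2 - 1) * (ch b ^+ 2 - 1)).
Proof.
move=> a0 b0; rewrite /ch opprD !expRD.
have ha : expR a * expR (- a) = 1 by rewrite -expRD subrr expR0.
have hb : expR b * expR (- b) = 1 by rewrite -expRD subrr expR0.
have a1 : expR (- a) <= expR a by rewrite ler_expR; lra.
have b1 : expR (- b) <= expR b by rewrite ler_expR; lra.
move: ha hb a1 b1.
set x := expR a; set x' := expR (- a); set y := expR b; set y' := expR (- b).
move=> ha hb a1 b1.
have -> : (((x + x') / 2) ^+ 2 - 1) * (((y + y') / 2) ^+ 2 - 1)
   = (((x - x') / 2) * ((y - y') / 2)) ^+ 2.
  have sq (p q : R) : p * q = 1 -> ((p + q) / 2) ^+ 2 - 1 = ((p - q) / 2) ^+ 2.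
    by move=> pq; rewrite -[X in _ - X = _]pq; field.
  by rewrite (sq _ _ ha) (sq _ _ hb) -exprMn.
rewrite sqrtr_sqr ger0_norm; last by apply: mulr_ge0; lra.
by field.
Qed.

End hyperbolic_cosine.

Section minkowski_form.
Variables (R : realType) (n : nat).
Implicit Types (x y z : 'rV[R]_n.+1).

Definition sdot x y : R :=
  \sum_(i < n) x 0 (lift ord0 i) * y 0 (lift ord0 i).

Lemma minkowskiE x y : minkowski x y = sdot x y - x 0 ord0 * y 0 ord0.
Proof. by []. Qed.

Lemma sdotC x y : sdot x y = sdot y x.
Proof. by apply: eq_bigr => i _; rewrite mulrC. Qed.

Lemma sdotDZl x y a z : sdot (x + a *: y) z = sdot x z + a * sdot y z.
Proof.
by rewrite /sdot big_distrr/= -big_split/=; apply: eq_bigr => i _; rewrite !mxE; ring.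
Qed.

Lemma minkowskiC x y : minkowski x y = minkowski y x.
Proof. by rewrite !minkowskiE sdotC mulrC. Qed.

Lemma minkowskiDZl x y a z :
  minkowski (x + a *: y) z = minkowski x z + a * minkowski y z.
Proof. by rewrite !minkowskiE sdotDZl !mxE; ring. Qed.

Lemma minkowskiDZr x y a z :
  minkowski z (x + a *: y) = minkowski z x + a * minkowski z y.
Proof. by rewrite !(minkowskiC z) minkowskiDZl. Qed.

Lemma minkowskiBl x y z : minkowski (x - y) z = minkowski x z - minkowski y z.
Proof. by rewrite -[- y]scaleN1r minkowskiDZl mulN1r. Qed.

Lemma minkowskiBr x y z : minkowski z (x - y) = minkowski z x - minkowski z y.
Proof. by rewrite !(minkowskiC z) minkowskiBl. Qed.

Lemma sdot_ge0 x : 0 <= sdot x x.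
Proof. by apply: sumr_ge0 => i _; rewrite -expr2 sqr_ge0. Qed.

Lemma discr_le0 (a b c : R) : 0 <= c ->
  (forall t, 0 <= a + 2 * t * b + t ^+ 2 * c) -> b ^+ 2 <= a * c.
Proof.
move=> c0 H.
have [c00|c00] := eqVneq c 0.
  subst c; rewrite mulr0.
  have [->|b0] := eqVneq b 0; first by rewrite expr0n.
  have := H (- (a + 1) / (2 * b)).
  have -> : a + 2 * (- (a + 1) / (2 * b)) * b + (- (a + 1) / (2 * b)) ^+ 2 * 0 = -1.
    by field.
  lra.
have cp : 0 < c by rewrite lt0r c00.
have := H (- b / c).
have -> : a + 2 * (- b / c) * b + (- b / c) ^+ 2 * c = (a * c - b ^+ 2) / c by field.
by rewrite pmulr_lge0 ?invr_gt0// subr_ge0.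
Qed.

Lemma sdot_CS x y : sdot x y ^+ 2 <= sdot x x * sdot y y.
Proof.
apply: discr_le0 => [|t]; first exact: sdot_ge0.
have := sdot_ge0 (x + t *: y).
rewrite sdotDZl !(sdotC _ (x + _)) !sdotDZl (sdotC y x) => h.
by apply: (le_trans h); rewrite le_eqVlt; apply/orP; left; apply/eqP; ring.
Qed.

(** The tangent space at a point of the hyperboloid is spacelike: the Euclidean Cauchy-Schwarz
    inequality bounds (u_0 y_0)^2 by |u|^2 (y_0^2 - 1), which is incompatible with |u|^2 < u_0^2. *)
Lemma minkowski_perp_ge0 (y u : 'rV[R]_n.+1) : minkowski y y = -1 ->
  minkowski u y = 0 -> 0 <= minkowski u u.
Proof.
rewrite !minkowskiE => yy uy; have := sdot_CS u y.
have -> : sdot u y = u 0 ord0 * y 0 ord0 by lra.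
have -> : sdot y y = y 0 ord0 * y 0 ord0 - 1 by lra.
have := sdot_ge0 y; have := sdot_ge0 u.
have -> : sdot y y = y 0 ord0 * y 0 ord0 - 1 by lra.
set S := sdot u u; set a := u 0 ord0; set b := y 0 ord0 => S0 b1 h.
rewrite leNgt; apply/negP => Sa.
have : 0 <= (a * a - S) * (b * b - 1) by apply: mulr_ge0; lra.
nra.
Qed.

Lemma minkowski_perp_CS (y u v : 'rV[R]_n.+1) : minkowski y y = -1 ->
  minkowski u y = 0 -> minkowski v y = 0 ->
  minkowski u v ^+ 2 <= minkowski u u * minkowski v v.
Proof.
move=> yy uy vy; apply: discr_le0 => [|t]; first exact: minkowski_perp_ge0 yy vy.
have : minkowski (u + t *: v) y = 0 by rewrite minkowskiDZl uy vy mulr0 addr0.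
move=> /(minkowski_perp_ge0 yy).
rewrite minkowskiDZl !minkowskiDZr (minkowskiC v u) => h.
by apply: (le_trans h); rewrite le_eqVlt; apply/orP; left; apply/eqP; ring.
Qed.

End minkowski_form.

Section hyperbolic_distance.
Variables (R : realType) (n : nat).
Implicit Types (x y z : hyp R n).

(** The hyperbolic cosine of the distance ([ch_dH]). Being polynomial in the coordinates, it is the
    form in which distances are computed and compared. *)
Definition chd x y : R := - minkowski (hcoord x) (hcoord y).

Lemma hyp_minkowski x : minkowski (hcoord x) (hcoord x) = -1.
Proof. by have /andP[/eqP] := hcoordP x. Qed.

Lemma hyp_gt0 x : 0 < hcoord x 0 ord0.
Proof. by have /andP[] := hcoordP x. Qed.

Lemma chdxx x : chd x x = 1.
Proof. by rewrite /chd hyp_minkowski opprK. Qed.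

Lemma chd_gt0 x y : 0 < chd x y.
Proof.
rewrite /chd minkowskiE.
have := sdot_CS (hcoord x) (hcoord y).
have := hyp_minkowski x; have := hyp_minkowski y; rewrite !minkowskiE => yy xx.
have -> : sdot (hcoord x) (hcoord x) = hcoord x 0 ord0 ^+ 2 - 1 by lra.
have -> : sdot (hcoord y) (hcoord y) = hcoord y 0 ord0 ^+ 2 - 1 by lra.
have := sdot_ge0 (hcoord x); have := sdot_ge0 (hcoord y).
have -> : sdot (hcoord x) (hcoord x) = hcoord x 0 ord0 ^+ 2 - 1 by lra.
have -> : sdot (hcoord y) (hcoord y) = hcoord y 0 ord0 ^+ 2 - 1 by lra.
have := hyp_gt0 x; have := hyp_gt0 y.
set a := hcoord x 0 ord0; set b := hcoord y 0 ord0; set s := sdot _ _.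
move=> b0 a0 b1 a1 h.
rewrite opprB subr_gt0 ltNge; apply/negP => ab.
have : (a * b) ^+ 2 <= s ^+ 2.
  by rewrite ler_sqr ?nnegrE//; [exact/ltW/mulr_gt0|nra].
nra.
Qed.

(** The component of x orthogonal to y has square [chd x y ^+ 2 - 1], which is nonnegative since
    that component is tangent at y. *)
Lemma chd_ge1 x y : 1 <= chd x y.
Proof.
have yy := hyp_minkowski y; have xx := hyp_minkowski x.
have : minkowski (hcoord x + (- chd x y) *: hcoord y) (hcoord y) = 0.
  by rewrite minkowskiDZl yy /chd; ring.
move=> /(minkowski_perp_ge0 yy).
rewrite minkowskiDZl !minkowskiDZr xx yy (minkowskiC (hcoord y)).
have -> : minkowski (hcoord x) (hcoord y) = - chd x y by rewrite opprK.
have := chd_gt0 x y; set A := chd x y => A0 h.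
have : 0 <= (A - 1) * (A + 1) by lra.
by rewrite pmulr_lge0 ?subr_ge0//; lra.
Qed.

Lemma ch_dH x y : ch (dH x y) = chd x y.
Proof. by rewrite ch_arcosh// chd_ge1. Qed.

Lemma dH_ge0 x y : 0 <= dH x y.
Proof. exact/arcosh_ge0/chd_ge1. Qed.

Lemma dH_leE x y (r : R) : 0 <= r -> (dH x y <= r) = (chd x y <= ch r).
Proof. by move=> r0; rewrite -ch_dH ler_ch// dH_ge0. Qed.

Lemma dHC x y : dH x y = dH y x.
Proof. by rewrite /dH minkowskiC. Qed.

Lemma dHxx x : dH x x = 0.
Proof.
by apply: le_anti; rewrite dH_ge0 andbT dH_leE// chdxx ch_ge1.
Qed.

(** Cauchy-Schwarz for the components [u] of x and [v] of z tangent at y reads (A B - cosh d(x,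
    z))^2 <= (A^2 - 1)(B^2 - 1), and [chD] turns this into the triangle inequality. *)
Lemma dH_triangle y x z : dH x z <= dH x y + dH y z.
Proof.
rewrite dH_leE ?addr_ge0 ?dH_ge0// chD ?dH_ge0// !ch_dH.
have xx := hyp_minkowski x; have yy := hyp_minkowski y.
have zz := hyp_minkowski z.
set A := chd x y; set B := chd y z.
pose u := hcoord x + (- A) *: hcoord y; pose v := hcoord z + (- B) *: hcoord y.
have xy : minkowski (hcoord x) (hcoord y) = - A by rewrite opprK.
have yz : minkowski (hcoord y) (hcoord z) = - B by rewrite opprK.
have uy : minkowski u (hcoord y) = 0 by rewrite minkowskiDZl yy xy; ring.
have vy : minkowski v (hcoord y) = 0.
  by rewrite minkowskiDZl yy minkowskiC yz; ring.
have := minkowski_perp_CS yy uy vy.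
have -> : minkowski u u = A ^+ 2 - 1.
  by rewrite minkowskiDZl !minkowskiDZr xx yy xy minkowskiC xy; ring.
have -> : minkowski v v = B ^+ 2 - 1.
  by rewrite minkowskiDZl !minkowskiDZr zz yy yz minkowskiC yz; ring.
have -> : minkowski u v = A * B - chd x z.
  by rewrite minkowskiDZl !minkowskiDZr yy xy yz /chd; ring.
by move=> /ler_wsqrtr; rewrite sqrtr_sqr ler_norml => /andP[]; lra.
Qed.

Lemma chd_le_sdot x y : chd x y <=
  1 + sdot (hcoord x - hcoord y) (hcoord x - hcoord y) / 2.
Proof.
have -> : chd x y = 1 + minkowski (hcoord x - hcoord y) (hcoord x - hcoord y) / 2.
  rewrite minkowskiBl !minkowskiBr !hyp_minkowski (minkowskiC (hcoord y)) /chd.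
  by field.
by rewrite lerD2l ler_pM2r ?invr_gt0// minkowskiE gerBl -expr2 sqr_ge0.
Qed.

End hyperbolic_distance.

Lemma continuous_sum (R : realType) (T : topologicalType) (I : Type) (s : seq I)
    (f : I -> T -> R) :
  (forall i, continuous (f i)) -> continuous (fun v => \sum_(i <- s) f i v).
Proof.
move=> cf v; elim: s => [|i s ih].
  by rewrite (_ : (fun _ => _) = cst 0); [exact: cvg_cst|apply/funext => w; rewrite big_nil].
rewrite (_ : (fun _ => _) = (fun w => f i w + \sum_(j <- s) f j w)).
  by apply: cvgD; [exact: cf|exact: ih].
by apply/funext => w; rewrite big_cons.
Qed.

Section topology.
Variables (R : realType) (n : nat).
Implicit Types (x y z : hyp R n).

Lemma minkowski_continuous (x : 'rV[R]_n.+1) : continuous (minkowski x).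
Proof.
have c i : continuous (fun v : 'rV[R]_n.+1 => x 0 i * v 0 i).
  by move=> v; apply: continuousM; [exact: cst_continuous|exact: coord_continuous].
move=> v; apply: (@continuousB R R^o _
  (fun v : 'rV[R]_n.+1 => \sum_(i < n) x 0 (lift ord0 i) * v 0 (lift ord0 i))
  (fun v : 'rV[R]_n.+1 => x 0 ord0 * v 0 ord0)); last exact: c.
by apply: continuous_sum => i; exact: c.
Qed.

Lemma minkowski_diag_continuous :
  continuous (fun v : 'rV[R]_n.+1 => minkowski v v).
Proof.
have c i : continuous (fun v : 'rV[R]_n.+1 => v 0 i * v 0 i).
  by move=> v; apply: continuousM; exact: coord_continuous.
move=> v; apply: (@continuousB R R^o _
  (fun v : 'rV[R]_n.+1 => \sum_(i < n) v 0 (lift ord0 i) * v 0 (lift ord0 i))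
  (fun v : 'rV[R]_n.+1 => v 0 ord0 * v 0 ord0)); last exact: c.
by apply: continuous_sum => i; exact: c.
Qed.

Lemma hcoord_continuous : continuous (@hcoord R n).
Proof. exact: initial_continuous. Qed.

Lemma chd_continuous x : continuous (chd x).
Proof.
move=> y; apply: (@continuousN R R^o _ (fun y => minkowski (hcoord x) (hcoord y))).
by apply: continuous_comp; [exact: hcoord_continuous|exact: minkowski_continuous].
Qed.

Lemma dH_continuous x : continuous (dH x).
Proof.
move=> y; have c := @chd_continuous x y.
have h : 0 < chd x y + Num.sqrt (chd x y ^+ 2 - 1).
  by rewrite ltr_wpDr ?sqrtr_ge0 ?chd_gt0.
apply: (@continuous_comp _ _ _ (fun y => chd x y + Num.sqrt (chd x y ^+ 2 - 1)) (@ln R));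
  last exact: continuous_ln.
apply: (cvgD c).
apply: (@continuous_comp _ _ _ (fun y => chd x y ^+ 2 - 1) Num.sqrt);
  last exact: sqrt_continuous.
apply: (@continuousB R R^o _ (fun y => chd x y ^+ 2) (cst 1)); last exact: cst_continuous.
exact: (cvgM c c).
Qed.

Lemma line_nonempty (L : line R n) : L !=set0.
Proof.
by case: (line_setP L) => c _ ->; exists (c 0), 0.
Qed.

Let has_lbound_dH x (A : set (hyp R n)) : has_lbound [set dH x y | y in A].
Proof. by exists 0 => _ [y _ <-]; exact: dH_ge0. Qed.

Lemma dH_set_le_point x (A : set (hyp R n)) y : A y -> dH_set x A <= dH x y.
Proof. by move=> Ay; apply: ge_inf; [exact: has_lbound_dH|exists y]. Qed.

Lemma dH_set_lt x (L : line R n) r : dH_set x L < r ->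
  exists2 y, line_set L y & dH x y < r.
Proof.
have [y0 Ly0] := line_nonempty L.
move=> /inf_lt-[|_ [y Ly <-]]; first by exists (dH x y0), y0.
by exists y.
Qed.

Lemma dH_set_le (L : line R n) x y : dH_set x L <= dH x y + dH_set y L.
Proof.
rewrite -lerBlDl; have [y0 Ly0] := line_nonempty L.
apply: lb_le_inf => [|_ [z Lz <-]]; first by exists (dH y y0), y0.
by rewrite lerBlDl (le_trans (dH_set_le_point _ Lz))// dH_triangle.
Qed.

Lemma closed_cylinder (L : line R n) : closed (cylinder L).
Proof.
apply: (@closed_comp _ _ (fun x => dH_set x L) [set t | t <= 1]) => [x _|];
  last exact: closed_le.
have FF : Filter (nbhs x) := nbhs_filter x.
apply/(@cvgrPdist_le _ R^o _ _ FF) => e e0.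
have := @dH_continuous x x => /(@cvgrPdist_le _ R^o _ _ FF)/(_ _ e0).
rewrite dHxx; apply: (@filterS _ (nbhs x) FF) => y; rewrite sub0r normrN ger0_norm ?dH_ge0// => xy.
have := dH_set_le L x y; have := dH_set_le L y x; rewrite (dHC y x).
by rewrite ler_norml; lra.
Qed.

Definition hbase_coord : 'rV[R]_n.+1 := \row_i (i == ord0)%:R.

Lemma hbase_subproof : (minkowski hbase_coord hbase_coord == -1) &&
  (0 < hbase_coord 0 ord0).
Proof.
rewrite /minkowski big1 => [|i _]; last by rewrite !mxE /= mul0r.
by rewrite !mxE/= mulr1 sub0r eqxx ltr01.
Qed.

Definition hbase : hyp R n := Hyp hbase_subproof.

Lemma chd_hbase x : chd hbase x = hcoord x 0 ord0.
Proof.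
rewrite /chd /minkowski big1 => [|i _]; last by rewrite !mxE /= mul0r.
by rewrite !mxE/= mul1r sub0r opprK.
Qed.

Lemma hcoord_le x r i : dH hbase x <= r -> `|hcoord x 0 i| <= ch r.
Proof.
move=> xr; have r0 : 0 <= r by apply: le_trans xr; exact: dH_ge0.
move: xr; rewrite dH_leE// chd_hbase => xr.
suff h : hcoord x 0 i ^+ 2 <= hcoord x 0 ord0 ^+ 2.
  apply: le_trans xr; have x0 := hyp_gt0 x.
  by move: h; rewrite -real_normK ?num_real// ler_sqr ?nnegrE ?(ltW x0).
have := hyp_minkowski x; rewrite minkowskiE => xx.
have [->//|[j ->]] : i = ord0 \/ exists j, i = lift ord0 j.
  by case: (unliftP ord0 i) => [j ->|->]; [right; exists j|left].
suff : hcoord x 0 (lift ord0 j) ^+ 2 <= sdot (hcoord x) (hcoord x).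
  by move=> h; apply: (le_trans h); rewrite -subr_le0 expr2 xx lerN10.
rewrite /sdot (bigD1 j)//= -expr2 lerDl.
by apply: sumr_ge0 => k _; rewrite -expr2 sqr_ge0.
Qed.

(** In coordinates the ball becomes a closed and bounded set [K], and every point of [K] comes from
    the ball. A cluster point found in [K] is pulled back, because the topology is the initial one
    for [hcoord]. *)
Lemma compact_hball x r : compact (hball x r).
Proof.
have [r0|r0] := leP 0 r; last first.
  have -> : hball x r = set0; last exact: compact0.
  by rewrite -subset0 => y xy; have := le_trans (dH_ge0 x y) xy; rewrite leNgt r0.
pose M := ch (dH hbase x + r).
pose K := [set v : 'rV[R]_n.+1 | [/\ minkowski v v = -1, 0 <= v 0 ord0,
   - minkowski (hcoord x) v <= ch r & forall i, v ord0 i \in `[- M, M] ]].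
have ballK y : hball x r y -> K (hcoord y).
  move=> /= xy; split.
  - exact: hyp_minkowski.
  - exact/ltW/hyp_gt0.
  - by rewrite -dH_leE.
  - move=> i; rewrite in_itv/= -ler_norml; apply: hcoord_le.
    by rewrite (le_trans (dH_triangle x _ _))// lerD2l.
have Kball v : K v -> exists2 y, hcoord y = v & hball x r y.
  move=> [vv v0 xv _].
  have vP : (minkowski v v == -1) && (0 < v 0 ord0).
    rewrite vv eqxx lt0r v0 andbT; apply/eqP => v00.
    by have := sdot_ge0 v; move: vv; rewrite minkowskiE v00; lra.
  by exists (Hyp vP) => //; rewrite /hball/= dH_leE.
have cK : compact K.
  have cB : compact [set v : 'rV[R]_n.+1 | forall i, v ord0 i \in `[- M, M] ].
    apply: (@rV_compact _  _ (fun=> `[- M, M]%classic)) => _; exact: segment_compact.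
  have -> : K = [set v | minkowski v v = -1] `&` [set v | 0 <= v 0 ord0] `&`
    [set v | - minkowski (hcoord x) v <= ch r] `&`
    [set v : 'rV[R]_n.+1 | forall i, v ord0 i \in `[- M, M] ].
    by apply/seteqP; split=> v; [case|case=> -[[]]].
  rewrite setIC; apply: compact_closedI => //.
  apply: closedI; first apply: closedI.
  - apply: (@closed_comp _ _ (fun v => minkowski v v) [set t | t = -1]) => [v _|];
      [exact: minkowski_diag_continuous|exact: closed_eq].
  - apply: (@closed_comp _ _ (fun v : 'rV[R]_n.+1 => v 0 ord0) [set t | 0 <= t]) => [v _|];
      [exact: coord_continuous|exact: closed_ge].
  - apply: (@closed_comp _ _ (fun v => - minkowski (hcoord x) v) [set t | t <= ch r]) => [v _|];
      [by apply: (@continuousN R R^o _ (minkowski (hcoord x))); exact: minkowski_continuous|exact: closed_le].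
move=> F FF FB; have FF' : Filter F by apply: filter_filter.
have FK : (@hcoord R n @ F) K by apply: (@filterS _ F FF' (hball x r)) FB.
have [v [/Kball[y <- xy] cv]] := cK _ (fmap_proper_filter (@hcoord R n) FF) FK.
exists y; split=> // A B FA yB.
have [U [[[V oV VU] Uy] UB]] : exists U, open_nbhs y U /\ U `<=` B.
  by move: yB; rewrite nbhsE => -[U oU UB]; exists U.
have [w [[a Aa <-] Va]] : @hcoord R n @` A `&` V !=set0.
  apply: cv; first by apply: (@filterS _ F FF' A) FA => a Aa; exists a.
  by apply: open_nbhs_nbhs; split=> //; move: Uy; rewrite -VU.
by exists a; split=> //; apply: UB; rewrite -VU.
Qed.

End topology.

(** * Isometries, packing and nets *)

Section isometries.
Variables (R : realType) (n : nat).
Implicit Types (x y z : hyp R n).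

(** Otherwise -v would lie on the upper sheet and have a positive [chd] to y, against the sign of
    [minkowski v (hcoord y)]. *)
Lemma hyp_sheet (v : 'rV[R]_n.+1) y : minkowski v v = -1 ->
  minkowski v (hcoord y) < 0 -> 0 < v 0 ord0.
Proof.
move=> vv vy; rewrite ltNge; apply/negP => v0.
have wP : (minkowski (0 + (-1) *: v) (0 + (-1) *: v) == -1) &&
    (0 < (0 + (-1) *: v) 0 ord0).
  have z0 u : minkowski (0 : 'rV[R]_n.+1) u = 0.
    by have := minkowskiBl 0 0 u; rewrite subr0 subrr.
  rewrite minkowskiDZl !minkowskiDZr z0 (minkowskiC v) z0 vv !mxE.
  apply/andP; split; first by apply/eqP; ring.
  rewrite mulN1r add0r lt0r oppr_ge0 v0 andbT oppr_eq0.
  by apply/eqP => v00; have := sdot_ge0 v; move: vv; rewrite minkowskiE v00; lra.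
have := chd_gt0 (Hyp wP) y; rewrite /chd/= minkowskiDZl.
have -> : minkowski (0 : 'rV[R]_n.+1) (hcoord y) = 0.
  by have := minkowskiBl 0 0 (hcoord y); rewrite subr0 subrr.
lra.
Qed.

(** Distance 0 stands in for equality of points throughout: the isometries below move a point only
    to distance 0 from its target, and this transfers to balls. *)
Lemma dH0_hball x y r : dH x y = 0 -> hball x r = hball y r.
Proof.
have h x' y' : dH x' y' = 0 -> hball x' r `<=` hball y' r.
  move=> xy z; rewrite /hball/= => xz; apply: le_trans xz.
  by rewrite (le_trans (dH_triangle x' _ _))// dHC xy add0r.
by move=> xy; apply/seteqP; split; apply: h; rewrite // dHC.
Qed.

(* The reflection in the bisector of x and y. *)
Lemma exists_reflection x y : exists g : hyp R n -> hyp R n,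
  [/\ hyp_isometry g, dH (g x) y = 0 &
      forall z, dH z x = dH z y -> dH (g z) z = 0].
Proof.
pose w := hcoord x - hcoord y; pose q := minkowski w w.
have qE : q = 2 * (chd x y - 1).
  rewrite /q /w minkowskiBl !minkowskiBr !hyp_minkowski.
  by rewrite (minkowskiC (hcoord y)) /chd; ring.
(* If [q] is 0 then x and y are at distance 0 and the identity serves; otherwise [s] is the Lorentz
   reflection in the hyperplane orthogonal to [w]. *)
have [q0|q0] := eqVneq q 0.
  exists id; split; [by split=> //; exists id| |by move=> z _; exact: dHxx].
  have xy : chd x y = 1 by lra.
  by apply: le_anti; rewrite dH_ge0 andbT dH_leE// xy ch_ge1.
pose s (v : 'rV[R]_n.+1) := v + (- (2 * minkowski v w / q)) *: w.
have sM u v : minkowski (s u) (s v) = minkowski u v.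
  rewrite /s minkowskiDZl !minkowskiDZr -/q (minkowskiC w v); field; exact: q0.
have sx : s (hcoord x) = hcoord y.
  have c : 2 * minkowski (hcoord x) w / q = 1.
    apply: (mulIf q0); rewrite mul1r divfK// qE /w minkowskiBr hyp_minkowski /chd.
    by ring.
  by rewrite /s c scaleN1r /w opprB addrC subrK.
have sP z : (minkowski (s (hcoord z)) (s (hcoord z)) == -1) && (0 < s (hcoord z) 0 ord0).
  rewrite sM hyp_minkowski eqxx/=; apply: (@hyp_sheet _ y).
    by rewrite sM hyp_minkowski.
  by rewrite -sx sM -oppr_gt0 chd_gt0.
pose g z := Hyp (sP z).
have sK : involutive s.
  move=> v; rewrite /s minkowskiDZl -/q; set a := minkowski v w.
  have -> : a + - (2 * a / q) * q = - a by field; exact: q0.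
  by rewrite mulrN mulNr opprK -addrA -scalerDl addNr scale0r addr0.
have gK : involutive g by move=> z; apply: val_inj => /=; exact: sK.
exists g; split.
- split; first exact: inv_bij gK.
  by move=> z z'; rewrite /dH /= sM.
- by rewrite (_ : g x = y) ?dHxx//; apply: val_inj.
- move=> z zxy.
  rewrite (_ : g z = z) ?dHxx//; apply: val_inj => /=.
  rewrite /s (_ : minkowski _ w = 0) ?mulr0 ?mul0r ?oppr0 ?scale0r ?addr0//.
  have : chd z x = chd z y by rewrite -!ch_dH zxy.
  by rewrite /w minkowskiBr /chd; lra.
Qed.

Lemma image_hball g x r : hyp_isometry g -> g @` hball x r = hball (g x) r.
Proof.
move=> [[f fK gK] gd]; apply/seteqP; split=> [_ [y xy <-]|y]; rewrite /hball/=.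
  by rewrite gd.
by move=> xy; exists (f y); rewrite ?gK// /hball/= -gd gK.
Qed.

Lemma isometry_inv g : hyp_isometry g -> exists f : hyp R n -> hyp R n,
  [/\ hyp_isometry f, cancel f g & cancel g f].
Proof.
move=> [[f fK gK] gd]; exists f; split=> //; split; first by exists g.
by move=> x y; rewrite -gd !gK.
Qed.

Lemma isometry_line g (L : set (hyp R n)) : hyp_isometry g -> is_line L ->
  is_line (g @` L).
Proof.
move=> [_ gd] [c cd ->]; exists (g \o c) => [s t|]; first by rewrite /= gd.
by apply/seteqP; split=> [_ [_ [t _ <-] <-]|_ [t _ <-]]; [exists t|exists (c t) => //; exists t].
Qed.

Lemma line_image_hitting2 g (A B : set (hyp R n)) : hyp_isometry g ->
  line_image g (hitting A `&` hitting B) =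
  hitting (g @` A) `&` hitting (g @` B).
Proof.
move=> gi; have [f [fi gK fK]] := isometry_inv gi.
apply/seteqP; split=> [L [L' [[a [L'a Aa]] [b [L'b Bb]]] LE]|L].
  split; rewrite /hitting/= LE.
    by exists (g a); split; exists a.
  by exists (g b); split; exists b.
move=> [[x [Lx [a Aa ga]]] [y [Ly [b Bb gb]]]].
exists (Line (isometry_line fi (line_setP L))).
  split.
    by exists a; split=> //; exists x => //; rewrite -ga fK.
  by exists b; split=> //; exists y => //; rewrite -gb fK.
rewrite /=; apply/seteqP; split=> [z Lz|_ [_ [z Lz <-] <-]]; last by rewrite gK.
by exists (f z); [exists z|rewrite gK].
Qed.

End isometries.

(** * The invariant measure of lines *)

Section sums_of_measures.
Context d (T : measurableType d) (R : realType).
Variable mu : {measure set T -> \bar R}.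

Lemma measure_seqU_le (I : Type) (s : seq I) (A : I -> set T) :
  (forall i, measurable (A i)) ->
  (mu (\big[setU/set0]_(i <- s) A i) <= \sum_(i <- s) mu (A i))%E.
Proof.
move=> mA; elim: s => [|i s ih]; first by rewrite !big_nil measure0.
rewrite !big_cons (le_trans (measureU2 _ _ _))//; first exact: bigsetU_measurable.
exact: leeD2l.
Qed.

(** Integrate the pointwise bound of the sum of the indicators of the [A i] by K times the indicator
    of B. *)
Lemma sum_measure_le (I : eqType) (s : seq I) (A : I -> set T) (B : set T)
    (K : nat) :
  (forall i, measurable (A i)) -> measurable B ->
  (forall i, i \in s -> A i `<=` B) ->
  (forall x, (count (fun i => x \in A i) s <= K)%N) ->
  (\sum_(i <- s) mu (A i) <= K%:R%:E * mu B)%E.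
Proof.
move=> mA mB AB AK.
have -> : (\sum_(i <- s) mu (A i) = \int[mu]_x (\sum_(i <- s) (\1_(A i) x)%:E))%E.
  rewrite ge0_integral_sum//.
  - by apply: eq_bigr => i _; rewrite integral_indic// setIT.
  - by move=> i; apply/measurable_EFinP; exact: measurable_indic.
have -> : (K%:R%:E * mu B = \int[mu]_x (K%:R * \1_B x)%:E)%E.
  under eq_integral do rewrite EFinM.
  by rewrite ge0_integralZl//= ?lee_fin// ?integral_indic ?setIT//; apply/measurable_EFinP; exact: measurable_indic.
apply: ge0_le_integral => //.
- by move=> x _; rewrite sume_ge0// => i _; rewrite lee_fin.
- by apply: emeasurable_sum => i; apply/measurable_EFinP; exact: measurable_indic.
- by apply/measurable_EFinP/measurable_funM => //; exact: measurable_indic.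
move=> x _; rewrite sumEFin lee_fin.
have -> : \sum_(i <- s) \1_(A i) x = (count (fun i => x \in A i) s)%:R :> R.
  by rewrite -sum1_count natr_sum [RHS]big_mkcond/=; apply: eq_bigr => i _; rewrite indicE; case: ifP.
rewrite indicE; have [xB|xB] := boolP (x \in B).
  by rewrite mulr1 ler_nat.
rewrite mulr0 (_ : count _ _ = 0)//; apply/eqP; rewrite -leqn0 leqNgt -has_count.
by apply/hasPn => i si; apply: contra xB; rewrite !inE; exact: AB.
Qed.

End sums_of_measures.

(** A longest duplicate-free list of elements of A must contain them all. *)
Lemma bounded_seq_enum (T : eqType) (A : set T) (M : nat) :
  (forall s : seq T, uniq s -> (forall x, x \in s -> A x) -> (size s <= M)%N) ->
  exists2 s : seq T, uniq s & forall x, x \in s <-> A x.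
Proof.
move=> AM.
pose P k := `[< exists s : seq T, [/\ uniq s, size s = k & forall x, x \in s -> A x] >].
have P0 : exists k, P k by exists 0%N; apply/asboolP; exists [::].
have PM k : P k -> (k <= M)%N by move=> /asboolP[s [us <- sA]]; exact: AM.
case: (ex_maxnP P0 PM) => k /asboolP[s [us sk sA]] kmax.
exists s => // x; split; first exact: sA.
move=> Ax; apply/negP => xs.
suff /kmax : P k.+1 by rewrite ltnn.
apply/asboolP; exists (x :: s); split=> /=; [by rewrite us andbT; apply/negP|by rewrite sk|].
by move=> y; rewrite inE => /orP[/eqP->|/sA].
Qed.

(** * Separated sets and nets *)

Section packing.
Variables (R : realType) (n : nat).
Implicit Types (x y z : hyp R n).

Definition dH_separated (e : R) (A : set (hyp R n)) : Prop :=
  forall x y, A x -> A y -> x != y -> e < dH x y.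

(** Pigeonhole: the coordinates other than 0 are rounded to a grid of mesh 1/k, and [chd_le_sdot]
    puts two points of the same cell within distance e. So M is the number of cells. *)
Lemma dH_hbase_packing (e r : R) : 0 < e -> exists M : nat, forall s : seq (hyp R n),
  uniq s -> dH_separated e [set` s] -> (forall x, x \in s -> dH (hbase R n) x <= r) ->
  (size s <= M)%N.
Proof.
move=> e0.
have h0 : 0 < ch e - 1.
  have := @ltr_ch R 0 e (lexx _) e0.
  by rewrite {1}/ch oppr0 expR0 -(mulr2n 1) divff ?pnatr_eq0// subr_gt0.
pose k : R := (Num.trunc (n%:R / (ch e - 1))).+1%:R.
have k1 : 1 <= k by rewrite ler1n.
have kn : n%:R / k <= ch e - 1.
  rewrite ler_pdivrMr ?(lt_le_trans ltr01)// mulrC -ler_pdivrMr//.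
  exact/ltW/truncnS_gt.
pose K : nat := Num.trunc (k * (2 * ch r)).
pose f x : {ffun 'I_n -> 'I_K.+1} :=
  [ffun i => inord (Num.trunc (k * (hcoord x 0 (lift ord0 i) + ch r)))].
exists #|{ffun 'I_n -> 'I_K.+1}| => s us ssep sr.
rewrite -(size_map f s).
have usf : uniq (map f s).
  rewrite map_inj_in_uniq// => x y xs ys fxy.
  apply/eqP/negPn/negP => xy.
  have := ssep _ _ xs ys xy; rewrite ltNge => /negP; apply.
  rewrite dH_leE ?(ltW e0)// (le_trans (chd_le_sdot _ _))// -lerBrDl.
  apply: le_trans kn.
  have : sdot (hcoord x - hcoord y) (hcoord x - hcoord y) <= n%:R / k ^+ 2.
    have -> : n%:R / k ^+ 2 = \sum_(i < n) (k ^+ 2)^-1.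
      by rewrite sumr_const card_ord mulr_natl.
    apply: ler_sum => i _; rewrite !mxE -expr2.
    have := congr1 (fun g : {ffun 'I_n -> 'I_K.+1} => nat_of_ord (g i)) fxy.
    have cx z : z \in s -> 0 <= k * (hcoord z 0 (lift ord0 i) + ch r) <= k * (2 * ch r).
      move=> zs; have := hcoord_le (lift ord0 i) (sr z zs); rewrite ler_norml => /andP[zl zr].
      have k0 : 0 < k by lra.
      by rewrite mulr_ge0 ?ler_pM2l//; lra.
    have /andP[x0 x1] := cx x xs; have /andP[y0 y1] := cx y ys.
    rewrite !ffunE !inordK ?ltnS ?le_truncn// => txy.
    have := truncn_itv x0; have := truncn_itv y0; rewrite txy -natr1.
    set t := (Num.trunc _)%:R.
    set a := hcoord x 0 _; set b := hcoord y 0 _ => /andP[b0 b1] /andP[a0 a1].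
    have : `|k * (a - b)| <= 1 by rewrite ler_norml; apply/andP; split; lra.
    have k0 : 0 < k by lra.
    rewrite normrM gtr0_norm// mulrC -ler_pdivlMr// => ab.
    by rewrite -(real_normK (num_real _)) -exprVn ler_sqr ?nnegrE ?invr_ge0 ?(ltW k0)// -div1r.
  move=> h; apply: le_trans (_ : n%:R / k ^+ 2 <= _).
    by apply: le_trans h; rewrite ler_pdivrMr// ler_peMr ?ler1n// sdot_ge0.
  rewrite ler_wpM2l// lef_pV2 ?posrE ?exprn_gt0 ?(lt_le_trans ltr01)//.
  by rewrite expr2 ler_peMr// (le_trans ler01).
by rewrite -(card_uniqP usf) max_card.
Qed.

(** A reflection moves the centre p to [hbase], so that one M serves all centres. *)
Lemma dH_packing (e r : R) : 0 < e -> exists M : nat, forall p (s : seq (hyp R n)),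
  uniq s -> dH_separated e [set` s] -> (forall x, x \in s -> dH p x <= r) ->
  (size s <= M)%N.
Proof.
move=> /dH_hbase_packing-/(_ r)[M HM]; exists M => p s us ssep sr.
have [g [gi gp _]] := exists_reflection p (hbase R n).
have ginj : injective g by case: gi => /bij_inj.
rewrite -(size_map g s); apply: HM.
- by rewrite map_inj_uniq.
- move=> _ _ /mapP[x xs ->] /mapP[y ys ->] gxy; rewrite gi.2; apply: ssep => //.
  by apply: contra gxy => /eqP->.
- move=> _ /mapP[x xs ->]; rewrite (le_trans (dH_triangle (g p) _ _))//.
  by rewrite dHC gp add0r gi.2 sr.
Qed.

Definition is_net (E : set (hyp R n)) : Prop :=
  [/\ dH_separated 4^-1 E, forall x, exists2 z, E z & dH x z <= 1 & countable E].

Lemma dH_separated_enum (e : R) (A : set (hyp R n)) x r : 0 < e -> dH_separated e A ->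
  exists2 s : seq (hyp R n), uniq s & forall z, z \in s <-> A z /\ dH x z <= r.
Proof.
move=> e0 As; have [M HM] := dH_packing r e0.
apply: (@bounded_seq_enum _ [set z | A z /\ dH x z <= r] M) => s us sA.
apply: (HM x) => // [y z /= /sA[Ay _] /sA[Az _]|y /sA[]//].
exact: As.
Qed.

(** The centres of a maximal family of disjoint balls of radius 1/4. A point farther than 1 from all
    of them could be added to the family; countability holds because each ball about [hbase]
    contains finitely many of them. *)
Lemma exists_net : exists E, is_net E.
Proof.
have [E [_ Etriv Emax]] :=
  ex_maximal_disjoint_subcollection (fun x : hyp R n => hball x 4^-1) setT.
have q0 : 0 <= 4^-1 :> R by rewrite invr_ge0.
have Es : dH_separated 4^-1 E.
  move=> x y Ex Ey; apply: contra_neqT; rewrite -leNgt => xy.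
  by apply: Etriv => //; exists y; rewrite /hball/= dHxx.
exists E; split => //.
- move=> x; apply/not_exists2P => Hx.
  have Ex : ~ E x.
    by move=> Ex; case: (Hx x) => // -[]; rewrite dHxx.
  apply: (Emax (E `|` [set x])) => //.
    by split=> [z Ez|H]; [left|apply: Ex; apply: H; right].
  have far z : E z -> hball z 4^-1 `&` hball x 4^-1 !=set0 -> False.
    move=> Ez [y [/= zy xy]]; case: (Hx z) => // -[].
    rewrite (le_trans (dH_triangle y _ _))// (dHC y).
    by move: zy xy; rewrite /hball/=; lra.
  move=> y z [Ey|->] [Ez|->] //; first exact: Etriv.
  - by move=> /(far _ Ey).
  - by rewrite setIC => /(far _ Ez).
- have -> : E = \bigcup_(k in [set: nat]) [set z | E z /\ dH (hbase R n) z <= k%:R].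
    apply/seteqP; split=> [z Ez|z [k _ []]//].
    exists (Num.trunc (dH (hbase R n) z)).+1 => //; split=> //.
    exact/ltW/truncnS_gt.
  apply: bigcup_countable => // k _; apply: finite_set_countable.
  have q1 : 0 < 4^-1 :> R by rewrite invr_gt0.
  have [s _ sE] := dH_separated_enum (hbase R n) k%:R q1 Es.
  by apply/finite_seqP; exists s; apply/seteqP; split=> z /=; rewrite sE.
Qed.

End packing.

(** * Lines hitting one or two balls *)

Section hitting_measure.
Variables (R : realType) (n : nat) (o : hyp R n.+1).
Variable mu : {measure set (line R n.+1) -> \bar R}.
Hypothesis hmu : invariant_line_measure o mu.
Implicit Types (x y z : hyp R n.+1).

Definition hit x (r : R) : set (line R n.+1) := hitting (hball x r).

Lemma hit_le x y r s : dH x y + r <= s -> hit x r `<=` hit y s.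
Proof.
move=> xys L [z [Lz xz]]; exists z; split=> //; apply: le_trans xys.
by rewrite /hball/= (le_trans (dH_triangle x _ _))// dHC lerD2l.
Qed.

Lemma measurable_hit x r : measurable (hit x r).
Proof.
apply: sub_sigma_algebra; exists (hball x r) => //; exact: compact_hball.
Qed.

Lemma measurable_hit2 x r y s : measurable (hit x r `&` hit y s).
Proof. by apply: measurableI; exact: measurable_hit. Qed.

Lemma mu_hit2_isometry g x r y s : hyp_isometry g ->
  mu (hit (g x) r `&` hit (g y) s) = mu (hit x r `&` hit y s).
Proof.
move=> gi; rewrite -(hmu.1 _ _ gi (measurable_hit2 x r y s)).
by rewrite line_image_hitting2// !image_hball.
Qed.

(* One reflection takes x to x', and a second one, which fixes x', takes the
   image of y to y'. *)
Lemma mu_hit2_dH x y x' y' r s : dH x y = dH x' y' ->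
  mu (hit x r `&` hit y s) = mu (hit x' r `&` hit y' s).
Proof.
move=> xy; have [g [gi gx _]] := exists_reflection x x'.
have [g' [gi' gy gfix]] := exists_reflection (g y) y'.
have gx' : dH (g' x') x' = 0.
  apply: gfix; rewrite -xy -(gi.2 x y).
  have := dH_triangle (g x) x' (g y); have := dH_triangle x' (g x) (g y).
  by rewrite (dHC x' (g x)) gx !add0r => ? ?; apply: le_anti; apply/andP.
rewrite -(mu_hit2_isometry x r y s gi) -(mu_hit2_isometry _ _ _ _ gi').
have gg : dH (g' (g x)) x' = 0.
  apply: le_anti; rewrite dH_ge0 andbT (le_trans (dH_triangle (g' x') _ _))//.
  by rewrite gi'.2 gx gx' addr0.
by rewrite /hit (dH0_hball _ gg) (dH0_hball _ gy).
Qed.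

Lemma mu_hit_eq x y r : mu (hit x r) = mu (hit y r).
Proof.
have := @mu_hit2_dH x x y y r r; rewrite !setIid !dHxx; exact.
Qed.

Lemma sphere_volume_gt0 k : 0 < sphere_volume R k.
Proof.
have : 0 < sphere_volume R k /\ 0 < sphere_volume R k.+1.
  elim: k => [|k [h0 h1]] /=; first by rewrite mulr_gt0 ?pi_gt0.
  by split=> //; rewrite mulr_gt0// divr_gt0// mulr_gt0 ?pi_gt0.
by case.
Qed.

(** Finitely many unit balls about net points cover the ball, and by invariance the lines hitting
    each have the normalized mass. *)
Lemma mu_hit_fin x r : (mu (hit x r) < +oo)%E.
Proof.
have [E [Es Ecov _]] := exists_net R n.+1.
have q1 : 0 < 4^-1 :> R by rewrite invr_gt0.
have [s _ sE] := dH_separated_enum x (r + 1) q1 Es.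
have : (mu (hit x r) <= \sum_(z <- s) mu (hit z 1))%E.
  apply: le_trans (measure_seqU_le mu s (fun z => measurable_hit z 1)).
  apply: le_measure; rewrite ?inE; first exact: measurable_hit.
    by apply: bigsetU_measurable => z _; exact: measurable_hit.
  move=> L [y [Ly xy]]; have [z Ez yz] := Ecov y.
  rewrite -bigcup_seq; exists z; last by exists y; split; rewrite // /hball/= dHC.
  apply/sE; split=> //; rewrite (le_trans (dH_triangle y _ _))// lerD//.
move=> /le_lt_trans; apply.
under eq_bigr do rewrite (mu_hit_eq _ o) hmu.2.
by rewrite sumEFin ltry.
Qed.

Lemma mu_hit2_fin x r y s : (mu (hit x r `&` hit y s) < +oo)%E.
Proof.
apply: le_lt_trans (mu_hit_fin x r).
apply: le_measure; rewrite ?inE; [exact: measurable_hit2|exact: measurable_hit|].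
exact: subIsetl.
Qed.

End hitting_measure.

(** * Exponential decay of the mass of lines hitting two distant balls *)

Section decay.
Variables (R : realType) (n : nat) (o : hyp R n.+2).
Variable mu : {measure set (line R n.+2) -> \bar R}.
Hypothesis hmu : invariant_line_measure o mu.
Implicit Types (x y z : hyp R n.+2).

(** The points lie on a quarter of a circle in the plane of the first two space coordinates, in the
    unit directions (t, sqrt (1 - t^2)) with t = i/N. Two directions are at Euclidean distance at
    least 1/N, and cosh of the hyperbolic distance is 1 + sinh^2 r times half the square of that
    distance. *)
Lemma exists_sphere_points (r : R) (N : nat) : 0 <= r ->
  exists p : 'I_N -> hyp R n.+2,
  (forall i, dH (hbase R n.+2) (p i) = r) /\
  forall i j, i != j ->
    1 + (ch r ^+ 2 - 1) / (2 * N%:R ^+ 2) <= ch (dH (p i) (p j)).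
Proof.
move=> r0; pose S2 := ch r ^+ 2 - 1; pose S := Num.sqrt S2.
have chr1 := ch_ge1 r.
have S20 : 0 <= S2 by rewrite /S2 subr_ge0 expr_ge1// (le_trans ler01).
have SS : S * S = S2 by rewrite -expr2 sqr_sqrtr.
pose t (i : 'I_N) : R := i%:R / N%:R; pose w i := Num.sqrt (1 - t i ^+ 2).
have t01 i : 0 <= t i <= 1.
  have N0 : (0 < N)%N by apply: leq_ltn_trans (ltn_ord i).
  by rewrite divr_ge0//= ler_pdivrMr ?ltr0n// mul1r ler_nat ltnW.
have ww i : w i * w i = 1 - t i ^+ 2.
  have /andP[ti0 ti1] := t01 i.
  by rewrite -expr2 sqr_sqrtr// subr_ge0 expr_le1.
pose v i : 'rV[R]_n.+3 := \row_j (if j == 0 :> nat then ch r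
   else if j == 1 :> nat then S * t i else if j == 2 :> nat then S * w i else 0).
have vv i j : minkowski (v i) (v j) = S2 * (t i * t j + w i * w j) - ch r ^+ 2.
  rewrite /minkowski !big_ord_recl big1 => [|k _]; last by rewrite !mxE/= mul0r.
  by rewrite !mxE/= -SS; ring.
have vP i : (minkowski (v i) (v i) == -1) && (0 < v i 0 ord0).
  rewrite vv ww !mxE/= (lt_le_trans ltr01)// andbT.
  by apply/eqP; rewrite /S2; ring.
exists (fun i => Hyp (vP i)); split=> [i|i j ij].
  apply: le_anti; rewrite dH_leE// chd_hbase/= mxE/= lexx/=.
  by rewrite -ler_ch ?dH_ge0// ch_dH chd_hbase/= mxE.
have N0 : 0 < N%:R :> R by rewrite ltr0n (leq_ltn_trans _ (ltn_ord i)).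
rewrite ch_dH /chd/= vv -/S2.
have -> : - (S2 * (t i * t j + w i * w j) - ch r ^+ 2) =
    1 + S2 * (1 - t i * t j - w i * w j) by rewrite /S2; ring.
rewrite lerD2l ler_wpM2l//.
have -> : 1 - t i * t j - w i * w j = ((t i - t j) ^+ 2 + (w i - w j) ^+ 2) / 2.
  have -> : (t i - t j) ^+ 2 + (w i - w j) ^+ 2 =
    t i ^+ 2 + t j ^+ 2 + w i * w i + w j * w j - 2 * t i * t j - 2 * w i * w j by ring.
  by rewrite !ww; field.
rewrite invfM [leRHS]mulrC ler_wpM2l ?invr_ge0//.
rewrite -[leLHS]addr0 lerD ?sqr_ge0//.
have -> : t i - t j = (i%:R - j%:R) / N%:R by rewrite mulrBl.
rewrite exprMn exprVn ler_peMl ?invr_ge0 ?sqr_ge0//.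
rewrite -real_normK ?num_real// expr_ge1// ?(le_trans ler01).
wlog ltij : i j ij / (i < j)%N.
  move=> H; case: (ltngtP i j) => [|/H|/val_inj ijE]; [exact: H| |by rewrite ijE eqxx in ij].
  by rewrite distrC; apply; rewrite eq_sym.
by rewrite distrC ger0_norm ?subr_ge0 ?ler_nat 1?ltnW// -natrB ?ler1n ?subn_gt0// ltnW.
Qed.

(** Both |t0 - t1| and |t0 - t2| differ from r by at most s + rho. On the same side of [t0] this
    gives |t1 - t2| <= 2 (s + rho), and passing from the line to x1 and x2 costs another 2 s. *)
Lemma line_hit_spread (c : R -> hyp R n.+2) y r rho s t0 t1 t2 x1 x2 :
  (forall s t, dH (c s) (c t) = `|s - t|) ->
  dH y (c t0) <= rho -> dH x1 (c t1) <= s -> dH x2 (c t2) <= s ->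
  dH y x1 = r -> dH y x2 = r -> (t0 <= t1) = (t0 <= t2) ->
  dH x1 x2 <= 4 * s + 2 * rho.
Proof.
move=> cd yc c1 c2 yx1 yx2 tt.
have h1 := cd t0 t1; have h2 := cd t0 t2; have h12 := cd t1 t2.
have a1 := dH_triangle (c t1) y x1; have b1 := dH_triangle y (c t0) (c t1).
have a2 := dH_triangle (c t2) y x2; have b2 := dH_triangle y (c t0) (c t2).
have e1 := dH_triangle (c t0) y (c t1); have f1 := dH_triangle x1 y (c t1).
have e2 := dH_triangle (c t0) y (c t2); have f2 := dH_triangle x2 y (c t2).
have g1 := dH_triangle (c t1) x1 x2; have g2 := dH_triangle (c t2) (c t1) x2.
move: a1 b1 a2 b2 e1 f1 e2 f2 g1 g2.
rewrite (dHC (c t1) x1) (dHC (c t2) x2) (dHC (c t0) y) h1 h2 h12 yx1 yx2.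
suff : `|t1 - t2| <= Num.max (`|t0 - t1| - `|t0 - t2|) (`|t0 - t2| - `|t0 - t1|).
  by rewrite le_max => /orP[]; lra.
rewrite le_max; apply/orP; move: tt.
have [H1|H1] := leP t0 t1; have [H2|H2] := leP t0 t2 => // _.
  rewrite (distrC t0 t1) (distrC t0 t2) (ger0_norm (_ : 0 <= t1 - t0)) ?subr_ge0//.
  rewrite (ger0_norm (_ : 0 <= t2 - t0)) ?subr_ge0//.
  by have [h|h] := leP t1 t2; [right; rewrite ler0_norm|left; rewrite ger0_norm]; lra.
have -> : `|t0 - t1| = t0 - t1 by rewrite ger0_norm// subr_ge0 ltW.
have -> : `|t0 - t2| = t0 - t2 by rewrite ger0_norm// subr_ge0 ltW.
by have [h|h] := leP t1 t2; [left; rewrite ler0_norm|right; rewrite ger0_norm]; lra.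
Qed.

(** For a = e^r this compares sinh r with e^r / 4. *)
Lemma sqr_sinh_ge (a : R) : 8 <= a -> (a / 4) ^+ 2 <= ((a - a^-1) / 2) ^+ 2.
Proof.
move=> a8; have av : a^-1 <= 1 by rewrite invf_le1; lra.
by rewrite ler_sqr ?nnegrE; lra.
Qed.

(** With y moved to [hbase] and x to any of N points at distance r, the mass m stays the same, and a
    line belongs to at most two of the N sets. Hence N m <= 2 [m0], where N is of order e^r / (8
    q). *)
Lemma mu_hit2_decay (rho : R) : 0 <= rho -> exists2 C : R, 0 <= C &
  forall y x s, 0 <= s ->
  (mu (hit y rho `&` hit x s) <= (C * expR (2 * s - dH y x))%:E)%E.
Proof.
move=> rho0; pose m0 := fine (mu (hit o rho)).
have m00 : 0 <= m0 by rewrite fine_ge0.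
have m0E y : mu (hit y rho) = m0%:E.
  rewrite (mu_hit_eq hmu y o) fineK// ge0_fin_numE//; exact: (mu_hit_fin hmu).
exists (32 * m0 * expR rho) => [|y x s s0]; first by rewrite !mulr_ge0 ?expR_ge0.
set r := dH y x; have r0 : 0 <= r by exact: dH_ge0.
pose a := expR r; pose q := expR (2 * s + rho).
have a0 : 0 < a by exact: expR_gt0.
have q0 : 0 < q by exact: expR_gt0.
have -> : 32 * m0 * expR rho * expR (2 * s - r) = 32 * m0 * (q / a).
  by rewrite /q /a expRD (expRD (2 * s)) expRN; ring.
(* For [a] below [8 * q] the claimed bound exceeds [m0] and is trivial. *)
have [qa|qa] := ltP a (8 * q).
  apply: (@le_trans _ _ m0%:E).
    rewrite -(m0E y); apply: le_measure; rewrite ?inE;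
      [exact: measurable_hit2|exact: measurable_hit|exact: subIsetl].
  rewrite lee_fin mulrAC ler_peMl// mulrA ler_pdivlMr// mul1r; lra.
(* This N keeps the points more than 4 s + 2 rho apart: cosh of that distance is at most q^2, while
   the separation is at least 1 + a^2 / (32 N^2) >= 1 + 2 q^2. *)
pose N := Num.trunc (a / (8 * q)).
have q80 : 0 < 8 * q by rewrite mulr_gt0.
have aq1 : 1 <= a / (8 * q) by rewrite ler_pdivlMr// mul1r.
have N1 : 1 <= N%:R :> R by rewrite ler1n truncn_gt0.
have /andP[Nle Nge] := truncn_itv (le_trans ler01 aq1).
rewrite -/N -[N.+1%:R]natr1 in Nle Nge.
have [p [pr psep]] := exists_sphere_points N r0.
have pfar i j : i != j -> 4 * s + 2 * rho < dH (p i) (p j).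
  move=> ij; rewrite ltNge; apply/negP => pij.
  have := psep i j ij.
  have D0 : 0 <= 4 * s + 2 * rho by rewrite addr_ge0 ?mulr_ge0.
  have : ch (dH (p i) (p j)) <= q ^+ 2.
    apply: (@le_trans _ _ (ch (4 * s + 2 * rho))); first by rewrite ler_ch ?dH_ge0.
    rewrite /q expr2 -expRD (_ : 2 * s + rho + (2 * s + rho) = 4 * s + 2 * rho); last by ring.
    rewrite /ch ler_pdivrMr// mulr_natr mulr2n lerD2l ler_expR; lra.
  move=> h1 h2; have := le_trans h2 h1; apply/negP; rewrite -ltNge.
  have a8 : 8 <= a.
    by apply: le_trans qa; rewrite ler_peMr// -expR0 ler_expR addr_ge0 ?mulr_ge0.
  have -> : ch r ^+ 2 - 1 = ((a - a^-1) / 2) ^+ 2.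
    by rewrite /ch expRN -/a; field; rewrite gt_eqF.
  have h4 := sqr_sinh_ge a8.
  have h5 : 8 * q * N%:R <= a by move: Nle; rewrite ler_pdivlMr// [_ * (8 * q)]mulrC.
  have h6 : (8 * q * N%:R) ^+ 2 <= a ^+ 2.
    have p0 : 0 <= 8 * q * N%:R by rewrite mulr_ge0// ltW.
    by rewrite ler_sqr ?nnegrE// ltW.
  have N20 : 0 < 2 * N%:R ^+ 2 :> R by rewrite mulr_gt0// exprn_gt0// (lt_le_trans ltr01).
  apply: (@lt_le_trans _ _ (1 + (a / 4) ^+ 2 / (2 * N%:R ^+ 2))); last first.
    by rewrite lerD2l ler_pM2r ?invr_gt0.
  apply: (@lt_le_trans _ _ (1 + q ^+ 2)); first by rewrite ltrDr.
  rewrite lerD2l ler_pdivlMr//.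
  have -> : q ^+ 2 * (2 * N%:R ^+ 2) = (8 * q * N%:R) ^+ 2 / 32 by field.
  have -> : (a / 4) ^+ 2 = a ^+ 2 / 16 by field.
  have := sqr_ge0 a; lra.
have : (\sum_(i <- index_enum 'I_N) mu (hit (hbase R n.+2) rho `&` hit (p i) s)
    <= 2%:R%:E * mu (hit (hbase R n.+2) rho))%E.
  apply: sum_measure_le => [i||i _|L].
  - exact: measurable_hit2.
  - exact: measurable_hit.
  - exact: subIsetl.
  rewrite -size_filter; set F := [seq i <- index_enum 'I_N | _].
  have [c cd Lc] := line_setP L.
  have [F0|/negP] := boolP (nilp F); first by rewrite (nilP F0).
  move=> F0.
  have [i0 i0F] : exists i, i \in F by case: (F) F0 => // i F' _; exists i; rewrite inE eqxx.
  have [t0 t0y] : exists t0, dH (hbase R n.+2) (c t0) <= rho.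
    move: i0F; rewrite mem_filter => /andP[+ _]; rewrite inE => -[[z [+ zy]] _].
    by rewrite Lc => -[t _ tz]; exists t; rewrite tz.
  have Fp i : i \in F -> exists t, dH (p i) (c t) <= s.
    rewrite mem_filter => /andP[+ _]; rewrite inE => -[_ [z [+ zy]]].
    by rewrite Lc => -[t _ tz]; exists t; rewrite tz.
  (* The side of [t0] on which the line comes near [p i]. By [line_hit_spread] it determines i,
     whence at most two indices. *)
  pose sg i := `[< exists2 t, t0 <= t & dH (p i) (c t) <= s >].
  have Fsg i : i \in F -> exists2 t, dH (p i) (c t) <= s & sg i = (t0 <= t).
    move=> /Fp[t ct]; rewrite /sg; have [[t' t0t' ct']|h] := asboolP.
      by exists t'.
    by exists t => //; apply/esym/negbTE/negP => t0t; apply: h; exists t.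
  rewrite -(size_map sg F).
  have uF : uniq (map sg F).
    rewrite map_inj_in_uniq ?filter_uniq ?index_enum_uniq// => i j /Fsg[t1 ct1 ->] /Fsg[t2 ct2 ->] tt.
    apply/eqP/negPn/negP => /pfar; rewrite ltNge => /negP; apply.
    exact: line_hit_spread cd t0y ct1 ct2 (pr i) (pr j) tt.
  by rewrite -(card_uniqP uF) (leq_trans (max_card _)) ?card_bool.
under eq_bigr do rewrite -(mu_hit2_dH hmu (x := y) (y := x)) ?pr//.
rewrite m0E; have mfin : mu (hit y rho `&` hit x s) \is a fin_num.
  by rewrite ge0_fin_numE//; exact: (mu_hit2_fin hmu).
move: (mu _) mfin => m mfin; rewrite -(fineK mfin) sumEFin sumr_const card_ord -EFinM !lee_fin => Hm.
have h5 : a <= 16 * q * N%:R.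
  have : a < (N%:R + 1) * (8 * q) by rewrite -ltr_pdivrMr.
  have : q * 1 <= q * N%:R by rewrite ler_pM2l.
  lra.
have N0 : 0 < N%:R :> R by lra.
rewrite -(ler_pM2l N0) [leLHS]mulr_natl (le_trans Hm)//.
have : m0 * (a / a) <= m0 * (16 * q * N%:R / a) by rewrite ler_wpM2l// ler_pM2r ?invr_gt0.
by rewrite divff ?gt_eqF// mulr1 => h; lra.
Qed.

End decay.

(** * Counting net points along a line and summing over the net *)

Lemma size_le_fibers (T : eqType) (s : seq T) (f : T -> nat) (K M : nat) :
  (forall x, x \in s -> (f x <= K)%N) ->
  (forall k, (count (fun x => f x == k) s <= M)%N) -> (size s <= M * K.+1)%N.
Proof.
move=> fK fM.
have -> : size s = (\sum_(k < K.+1) count (fun x => f x == k) s)%N.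
  transitivity (\sum_(k < K.+1) \sum_(x <- s) (f x == k :> nat))%N; last first.
    by apply: eq_bigr => k _; rewrite -sum1_count [RHS]big_mkcond; apply: eq_bigr => x _; case: eqP.
  rewrite exchange_big/= -sum1_size big_seq [RHS]big_seq; apply: eq_bigr => x xs.
  have fxK : (f x < K.+1)%N by rewrite ltnS fK.
  rewrite (bigD1 (Ordinal fxK))//= eqxx big1// => k kx.
  by case: eqP => // fxk; rewrite -val_eqE/= fxk eqxx in kx.
apply: (@leq_trans (\sum_(k < K.+1) M)); first exact: leq_sum.
by rewrite sum_nat_const card_ord mulnC.
Qed.

(** Half of the exponent absorbs the affine factor, as 4 j + b <= (b + 4/a)(1 + a j) <= (b + 4/a)
    e^(a j); the other half leaves a geometric series. *)
Lemma affine_exp_series (R : realType) (a b : R) : 0 < a -> 0 <= b ->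
  exists2 C : R, 0 <= C &
  forall J : nat, \sum_(j < J) (4 * j%:R + b) * expR (- (a * 2) * j%:R) <= C.
Proof.
move=> a0 b0; pose q := expR (- a).
have q1 : q < 1 by rewrite expR_lt1; lra.
have q0 : 0 < q := expR_gt0 _.
have geo J : \sum_(j < J) q ^+ j <= (1 - q)^-1.
  rewrite -div1r ler_pdivlMr ?subr_gt0// mulrC.
  have -> : (1 - q) * \sum_(j < J) q ^+ j = 1 - q ^+ J.
    by rewrite -[1 - q ^+ J]opprB subrX1 -mulNr opprB.
  by rewrite gerBl exprn_ge0// ltW.
have C0 : 0 <= b + 4 / a by rewrite addr_ge0// divr_ge0// ltW.
exists ((b + 4 / a) * (1 - q)^-1) => [|J].
  by rewrite mulr_ge0// invr_ge0 subr_ge0 ltW.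
apply: le_trans (ler_wpM2l C0 (geo J)).
rewrite mulr_sumr; apply: ler_sum => j _.
have -> : expR (- (a * 2) * j%:R) = expR (- (a * j%:R)) * q ^+ j.
  by rewrite /q -expRM_natl -expRD; congr expR; rewrite -mulr_natl; ring.
rewrite mulrA ler_wpM2r ?exprn_ge0 ?(ltW q0)//.
rewrite expRN ler_pdivrMr ?expR_gt0//.
apply: (@le_trans _ _ ((b + 4 / a) * (1 + a * j%:R))).
  have -> : (b + 4 / a) * (1 + a * j%:R) = 4 * j%:R + b + (b * a * j%:R + 4 / a).
    by field; rewrite gt_eqF.
  by rewrite lerDl addr_ge0 ?divr_ge0 ?mulr_ge0// ltW.
by rewrite ler_wpM2l// expR_ge1Dx.
Qed.

Section line_count.
Variables (R : realType) (n : nat).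
Implicit Types (x y z : hyp R n).

(** Each z is within rho of a point [c (T z)] of the line, and these parameters fill an interval of
    length at most 4 r + 4 rho. Those z whose parameters lie in one unit interval are in a ball of
    radius rho + 1, so packing bounds their number. *)
Lemma line_count (rho : R) : 0 <= rho -> exists M : nat,
  forall (L : line R n) x r (s : seq (hyp R n)), 0 <= r ->
  uniq s -> dH_separated 4^-1 [set` s] ->
  (forall z, z \in s -> dH x z <= r /\ hitting (hball z rho) L) ->
  (size s)%:R <= M%:R * (4 * r + 4 * rho + 1).
Proof.
move=> rho0; have q1 : 0 < 4^-1 :> R by rewrite invr_gt0.
have [M HM] := @dH_packing R n _ (rho + 1) q1.
exists M => L x r s r0 us ss sL.
have [->|/eqP] := eqVneq s [::].
  by rewrite mulr_ge0// !addr_ge0// mulr_ge0.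
case: s us ss sL => // z0 s' us ss sL _; set s := z0 :: s' in us ss sL *.
have z0s : z0 \in s by rewrite inE eqxx.
move: s us ss sL z0s => s us ss sL z0s.
have [c cd Lc] := line_setP L.
have [T HT] : exists T : hyp R n -> R, forall z, z \in s -> dH z (c (T z)) <= rho.
  have /choice[T HT] : forall z, exists t, z \in s -> dH z (c t) <= rho.
    move=> z; have [zs|_] := boolP (z \in s); last by exists 0.
    have [_ [y [+ zy]]] := sL z zs.
    by rewrite Lc => -[t _ ty]; exists t => _; rewrite ty.
  by exists T.
have TT z w : z \in s -> w \in s -> `|T z - T w| <= 2 * r + 2 * rho.
  move=> zs ws; rewrite -cd.
  have := HT z zs; have := HT w ws; have := (sL z zs).1; have := (sL w ws).1.
  have := dH_triangle z (c (T z)) (c (T w)); rewrite (dHC _ z).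
  have := dH_triangle x z (c (T w)); rewrite (dHC z x).
  have := dH_triangle w x (c (T w)).
  lra.
pose D := 2 * r + 2 * rho.
(* The shift by [D] makes the argument nonnegative, so that truncation is the integer part. *)
pose f z := Num.trunc (T z - T z0 + D).
have f0 z : z \in s -> 0 <= T z - T z0 + D <= 4 * r + 4 * rho.
  by move=> zs; have := TT z z0 zs z0s; rewrite ler_norml /D => /andP[]; lra.
have sz : (size s <= M * (Num.trunc (4 * r + 4 * rho)).+1)%N.
  apply: (@size_le_fibers _ s f) => [z zs|k].
    by have /andP[_ ?] := f0 z zs; exact: le_truncn.
  rewrite -size_filter; apply: (HM (c (T z0 - D + k%:R))).
  - exact: filter_uniq.
  - move=> y z /=; rewrite !mem_filter => /andP[_ ys] /andP[_ zs]; exact: ss.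
  - move=> z; rewrite mem_filter => /andP[/eqP fk zs].
    apply: le_trans (dH_triangle (c (T z)) _ _) _.
    rewrite addrC lerD// 1?dHC ?HT// cd.
    have /andP[z1 _] := f0 z zs.
    by have := truncn_itv z1; rewrite -/(f z) fk -[k.+1%:R]natr1 ler_norml => /andP[]; lra.
apply: (@le_trans _ _ (M * (Num.trunc (4 * r + 4 * rho)).+1)%:R).
  by rewrite ler_nat.
rewrite natrM ler_wpM2l// -natr1 lerD2r.
by rewrite truncn_le addr_ge0 ?mulr_ge0.
Qed.

End line_count.

Section net_sums.
Variables (R : realType) (n : nat) (o : hyp R n.+2).
Variable mu : {measure set (line R n.+2) -> \bar R}.
Hypothesis hmu : invariant_line_measure o mu.
Implicit Types (x y z : hyp R n.+2).

Definition mass2 (rho : R) y z : R := fine (mu (hit y rho `&` hit z rho)).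

Lemma mass2_ge0 rho y z : 0 <= mass2 rho y z.
Proof. exact: fine_ge0. Qed.

Lemma mass2E rho y z : mu (hit y rho `&` hit z rho) = (mass2 rho y z)%:E.
Proof. by rewrite fineK// ge0_fin_numE//; exact: (mu_hit2_fin hmu). Qed.

(** When 2 r >= d(x, y) the mass of the lines hitting one ball is bound enough. Otherwise the
    exponent of the decay is negative and multiplying it by a <= 1 only weakens the bound; the
    factor e^(2 b) goes into C. *)
Lemma mu_hit2_le_exp (rho b : R) : 0 <= rho -> 0 <= b -> exists2 C : R, 0 <= C &
  forall (a : R) x y (r : R), 0 <= a <= 1 -> 0 <= r ->
  (mu (hit y rho `&` hit x (r + b)) <=
    (C * expR (a * (2 * r - dH x y)))%:E)%E.
Proof.
move=> rho0 b0; have [C C0 HC] := mu_hit2_decay hmu rho0.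
have m00 : 0 <= fine (mu (hit o rho)) by exact: fine_ge0.
have C10 : 0 <= C * expR (2 * b) by rewrite mulr_ge0// expR_ge0.
exists (fine (mu (hit o rho)) + C * expR (2 * b)) => [|a x y r /andP[a0 a1] r0].
  exact: addr_ge0.
have [t0|t0] := leP 0 (2 * r - dH x y).
  apply: (@le_trans _ _ (fine (mu (hit o rho)))%:E).
    rewrite fineK ?ge0_fin_numE// ?(mu_hit_fin hmu)// (mu_hit_eq hmu o y).
    apply: le_measure; rewrite ?inE;
      [exact: measurable_hit2|exact: measurable_hit|exact: subIsetl].
  rewrite lee_fin [leRHS]mulrDl ler_wpDr ?mulr_ge0 ?expR_ge0//.
  by rewrite ler_peMr// -{1}expR0 ler_expR mulr_ge0.
apply: le_trans (HC _ _ _ (addr_ge0 r0 b0)) _.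
rewrite lee_fin [leRHS]mulrDl ler_wpDl ?mulr_ge0 ?expR_ge0//.
rewrite -mulrA -expRD ler_wpM2l// ler_expR (dHC y x).
have : (1 - a) * (2 * r - dH x y) <= 0 by rewrite mulr_ge0_le0; lra.
lra.
Qed.

(** All the sets lie in the set of lines hitting B(y, rho) and B(x, j + 1 + rho), and [line_count]
    bounds by [K] how many of them contain a given line. *)
Lemma net_sum_shell (rho : R) : 0 <= rho -> exists2 C : R, 0 <= C &
  forall x y (s : seq (hyp R n.+2)) (j : nat) (a : R), 0 <= a <= 1 ->
  uniq s -> dH_separated 4^-1 [set` s] ->
  (forall z, z \in s -> dH x z <= j.+1%:R) ->
  \sum_(z <- s) mass2 rho y z <=
  C * (4 * j%:R + (5 + 4 * rho)) * expR (a * (2 * j%:R - dH x y)).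
Proof.
move=> rho0; have rho10 : 0 <= 1 + rho by rewrite addr_ge0.
have [C C0 HC] := mu_hit2_le_exp rho0 rho10.
have [M HM] := @line_count R n.+2 _ rho0.
exists (M%:R * C) => [|x y s j a a01 us ss sx]; first exact: mulr_ge0.
have [K KE] : exists K : nat, K%:R <= M%:R * (4 * j.+1%:R + 4 * rho + 1) :> R /\
    forall L, (count (fun z => L \in hit y rho `&` hit z rho) s <= K)%N.
  pose X : R := M%:R * (4 * j.+1%:R + 4 * rho + 1).
  have X0 : 0 <= X by rewrite mulr_ge0// !addr_ge0// mulr_ge0.
  exists (Num.trunc X); split=> [|L]; first by rewrite truncn_le.
  rewrite truncn_ge_nat// -size_filter; apply: (HM L x) => //.
  - exact: filter_uniq.
  - by move=> u v /=; rewrite !mem_filter => /andP[_ us'] /andP[_ vs']; exact: ss.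
  - by move=> z; rewrite mem_filter => /andP[+ /sx xz]; rewrite inE => -[].
have := @sum_measure_le _ _ _ mu _ s (fun z => hit y rho `&` hit z rho)
  (hit y rho `&` hit x (j%:R + (1 + rho))) K.
under eq_bigr do rewrite mass2E.
rewrite sumEFin => /(_ _ _ _ KE.2) H.
have {}H : ((\sum_(z <- s) mass2 rho y z)%:E <=
    K%:R%:E * mu (hit y rho `&` hit x (j%:R + (1 + rho))))%E.
  apply: H => [z||z zs L [yL zL]]; [exact: measurable_hit2|exact: measurable_hit2|].
  split=> //; apply: hit_le zL; rewrite dHC addrA lerD2r.
  by rewrite (le_trans (sx z zs))// -natr1.
rewrite -lee_fin (le_trans H)//.
apply: (@le_trans _ _ (K%:R%:E * (C * expR (a * (2 * j%:R - dH x y)))%:E)%E).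
  by apply: lee_wpmul2l; [rewrite lee_fin|exact: HC].
rewrite -EFinM lee_fin mulrA ler_wpM2r ?expR_ge0//.
rewrite [M%:R * C]mulrC -mulrA [C * _]mulrC ler_wpM2r//.
by rewrite (le_trans KE.1)// -natr1 ler_wpM2l//; lra.
Qed.

(** Group the z by the integer part j of d(x, z). The weight is at most e^(- a j), and the shell
    bound with exponent a/4 grows only like j e^(a j / 2), so the series over j converges and e^(-
    (a/4) d(x, y)) factors out. *)
Lemma net_sum_step (rho a : R) : 0 <= rho -> 0 < a <= 1 ->
  exists2 C : R, 0 <= C &
  forall x y (s : seq (hyp R n.+2)), uniq s -> dH_separated 4^-1 [set` s] ->
  \sum_(z <- s) mass2 rho y z * expR (- (a * dH x z)) <=
  C * expR (- (a / 4 * dH x y)).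
Proof.
move=> rho0 /andP[a0 a1]; have [C C0 HC] := net_sum_shell rho0.
have a40 : 0 < a / 4 by rewrite divr_gt0.
have b0 : 0 <= 5 + 4 * rho by rewrite addr_ge0// mulr_ge0.
have [D D0 HD] := affine_exp_series a40 b0.
exists (C * D) => [|x y s us ss]; first exact: mulr_ge0.
pose f z := Num.trunc (dH x z).
have ff z : (f z)%:R <= dH x z < (f z).+1%:R := truncn_itv (dH_ge0 x z).
pose J := (\max_(z <- s) f z).+1.
have fJ z : z \in s -> (f z < J)%N.
  by move=> zs; rewrite ltnS; exact: leq_bigmax_seq.
have -> : \sum_(z <- s) mass2 rho y z * expR (- (a * dH x z)) =
    \sum_(j < J) \sum_(z <- [seq z <- s | f z == j]) mass2 rho y z * expR (- (a * dH x z)).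
  under [RHS]eq_bigr do rewrite big_filter big_mkcond/=.
  rewrite exchange_big/= big_seq [RHS]big_seq; apply: eq_bigr => z /fJ zJ.
  rewrite (bigD1 (Ordinal zJ))//= eqxx big1 ?addr0// => k kz.
  by case: eqP => // fzk; rewrite -val_eqE/= fzk eqxx in kz.
apply: (@le_trans _ _ (\sum_(j < J) expR (- (a * j%:R)) *
    (C * (4 * j%:R + (5 + 4 * rho)) * expR (a / 4 * (2 * j%:R - dH x y))))).
  apply: ler_sum => j _; set sj := [seq z <- s | _].
  apply: (@le_trans _ _ (expR (- (a * j%:R)) * \sum_(z <- sj) mass2 rho y z)).
    rewrite mulr_sumr big_seq [leRHS]big_seq; apply: ler_sum => z.
    rewrite mem_filter => /andP[/eqP fz _].
    rewrite mulrC ler_wpM2r ?mass2_ge0// ler_expR lerN2 ler_wpM2l ?(ltW a0)//.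
    by have /andP[+ _] := ff z; rewrite fz.
  rewrite ler_wpM2l ?expR_ge0//; apply: HC; first by lra.
  - exact: filter_uniq.
  - by move=> u v /=; rewrite !mem_filter => /andP[_ us'] /andP[_ vs']; exact: ss.
  - by move=> z; rewrite mem_filter => /andP[/eqP fz _]; have /andP[_ /ltW] := ff z; rewrite fz.
apply: (@le_trans _ _ (C * expR (- (a / 4 * dH x y)) *
    \sum_(j < J) (4 * j%:R + (5 + 4 * rho)) * expR (- (a / 4 * 2) * j%:R))).
  rewrite mulr_sumr le_eqVlt; apply/orP; left; apply/eqP; apply: eq_bigr => j _.
  have -> : a / 4 * (2 * j%:R - dH x y) = - (a / 4 * dH x y) + a / 4 * 2 * j%:R by ring.
  have -> : - (a / 4 * 2) * j%:R = - (a * j%:R) + a / 4 * 2 * j%:R by field.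
  rewrite !expRD; ring.
rewrite mulrAC ler_wpM2r ?expR_ge0// ler_wpM2l//.
Qed.

Lemma exists_far x (r : R) : 0 <= r -> exists y, dH x y = r.
Proof.
move=> r0; have [p [pr _]] := @exists_sphere_points R n r 1 r0.
have [g [gi gx _]] := exists_reflection (hbase R n.+2) x.
exists (g (p ord0)); rewrite -(pr ord0) -(gi.2 (hbase R n.+2)).
have := dH_triangle (g (hbase R n.+2)) x (g (p ord0)).
have := dH_triangle x (g (hbase R n.+2)) (g (p ord0)).
by rewrite (dHC x (g (hbase _ _))) gx !add0r => ? ?; apply: le_anti; apply/andP.
Qed.

(* The lines hitting a ball far away hardly meet the lines hitting a given
   one, so that new mass is added again and again. *)
Lemma mu_hit_unbounded (A : R) :
  exists2 rho : R, 3 <= rho & (A%:E <= mu (hit o rho))%E.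
Proof.
pose c := sphere_volume R n.+1; have c0 : 0 < c := sphere_volume_gt0 R _.
have mc x : mu (hit x 1) = c%:E by rewrite (mu_hit_eq hmu x o); exact: hmu.2.
suff [rho rho3 H] : exists2 rho : R, 3 <= rho &
    (((Num.trunc (A / (c / 2))).+1%:R * (c / 2))%:E <= mu (hit o rho))%E.
  exists rho => //; apply: le_trans H; rewrite lee_fin -ler_pdivrMr ?divr_gt0//.
  exact/ltW/truncnS_gt.
move: (Num.trunc _).+1 => N; elim: N => [|k [rho rho3 IH]]; first by exists 3; rewrite // mul0r.
have [C C0 HC] := mu_hit2_decay hmu ler01.
have C2c : 0 <= 2 * C / c by rewrite divr_ge0 ?mulr_ge0// ltW.
have rho0 : 0 <= rho by lra.
(* At this distance C e^(2 rho - d) = C e^(- 2 C / c) <= c / 2, so at least half of the mass [c] of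
   [hit x 1] is new. *)
have [x xo] : exists x, dH o x = 2 * rho + 2 * C / c.
  by apply: exists_far; rewrite addr_ge0// mulr_ge0.
exists (dH o x + rho + 1); first by have := dH_ge0 o x; lra.
have small : (mu (hit x 1 `&` hit o rho) <= (c / 2)%:E)%E.
  apply: le_trans (HC _ _ _ rho0) _; rewrite lee_fin dHC xo.
  have -> : 2 * rho - (2 * rho + 2 * C / c) = - (2 * C / c) by ring.
  rewrite expRN ler_pdivrMr ?expR_gt0//.
  apply: (@le_trans _ _ (c / 2 * (1 + 2 * C / c))).
    have -> : c / 2 * (1 + 2 * C / c) = c / 2 + C by field; rewrite gt_eqF.
    by rewrite lerDr divr_ge0// ltW.
  by rewrite ler_wpM2l ?expR_ge1Dx// divr_ge0// ltW.
have big : ((c / 2)%:E <= mu (hit x 1 `\` hit o rho))%E.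
  have := mc x.
  have -> : (mu (hit x 1) = mu (hit x 1 `\` hit o rho) + mu (hit x 1 `&` hit o rho))%E.
    by apply: measureDI; exact: measurable_hit.
  have := mu_hit2_fin hmu x 1 o rho.
  have := small; have : (0 <= mu (hit x 1 `&` hit o rho))%E by [].
  move: (mu (_ `&` _)) => [m| |] //; rewrite !lee_fin => m0 mc2 _.
  move: (mu _) => [m'| |] //; rewrite ?leey// -EFinD => -[e].
  by rewrite lee_fin; lra.
apply: (@le_trans _ _ (mu (hit o rho `|` (hit x 1 `\` hit o rho)))).
  rewrite measureU; first last.
  - by rewrite -subset0 => L [/[swap] -[]].
  - by apply: measurableD; exact: measurable_hit.
  - exact: measurable_hit.
  by rewrite -natr1 mulrDl mul1r EFinD leeD.
apply: le_measure; rewrite ?inE.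
- by apply: measurableU; [|apply: measurableD]; exact: measurable_hit.
- exact: measurable_hit.
move=> L [oL|[xL _]].
  by apply: hit_le oL; rewrite dHxx add0r -addrA addrC -addrA lerDl addr_ge0 ?dH_ge0.
by apply: hit_le xL; rewrite (dHC x o) lerD2r lerDl.
Qed.

End net_sums.

(** * Poisson processes *)

Lemma sum_measure_trivIset_le d (T : measurableType d) (R : realType)
    (mu : {measure set T -> \bar R}) (I : finType) (A : I -> set T) (B : set T) :
  (forall i, measurable (A i)) -> measurable B -> trivIset setT A ->
  (forall i, A i `<=` B) -> (\sum_i mu (A i) <= mu B)%E.
Proof.
move=> mA mB At AB; rewrite -[leRHS]mul1e.
apply: (@sum_measure_le _ _ _ mu _ (index_enum I) A B 1) => // x.
rewrite -size_filter; set F := [seq i <- index_enum I | _].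
have uF : uniq F by rewrite filter_uniq// index_enum_uniq.
have FA i : i \in F -> A i x by rewrite mem_filter => /andP[/set_mem].
case: F uF FA => [|i [|j F]]//= /andP[+ _] FA; rewrite inE negb_or => /andP[/eqP + _].
by case; apply: At => //; exists x; split; apply: FA; rewrite !inE eqxx ?orbT.
Qed.

Section counts.
Variables (R : realType) (E : choiceType) (w : E -> nat).

Lemma pcount_ge_size (A : set E) (s : seq E) : uniq s ->
  (forall x, x \in s -> A x /\ w x != 0%N) -> ((size s)%:R%:E <= pcount R w A)%E.
Proof.
move=> us sA; apply: esum_ge; exists [set` s].
  by split; [exact: finite_seq|move=> x /= /sA[]].
rewrite -fsbig_seq//= sumEFin lee_fin -natr_sum ler_nat -sum1_size.
rewrite big_seq [leqRHS]big_seq; apply: leq_sum => x /sA[_].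
by rewrite -lt0n.
Qed.

Lemma pcount_neq0 (A : set E) : pcount R w A != 0%E -> exists2 x, A x & w x != 0%N.
Proof.
move=> /eqP A0; apply: contrapT => H; apply: A0; apply: esum1 => x Ax.
have [->//|wx] := eqVneq (w x) 0%N.
by exfalso; apply: H; exists x.
Qed.

End counts.

(** Since (i + k)! >= i!, the terms from index k on are at most x^k times the terms of the whole
    series. *)
Lemma expR_le_taylor (R : realType) (x : R) (k : nat) : 0 <= x ->
  expR x <= x ^+ k * expR x + \sum_(i < k) x ^+ i / i`!%:R.
Proof.
move=> x0.
have partial m : \sum_(i < m) x ^+ i / i`!%:R <= expR x.
  have := @nondecreasing_cvgn_le R (series (exp_coeff x)) _ _ m.
  rewrite /series/= big_mkord; apply; last exact: is_cvg_series_exp_coeff.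
  apply/nondecreasing_seqP => i.
  by rewrite /series/= big_nat_recr//= lerDl exp_coeff_ge0.
rewrite {1}/expR; apply: limr_le; first exact: is_cvg_series_exp_coeff.
near=> m.
have km : (k <= m)%N by near: m; exact: nbhs_infty_ge.
rewrite /series/= (big_cat_nat (leq0n k) km)//= addrC big_mkord lerD2r.
rewrite -{1}(add0n k) big_addn big_mkord.
apply: le_trans (ler_wpM2l (exprn_ge0 k x0) (partial (m - k)%N)).
rewrite mulr_sumr; apply: ler_sum => i _; rewrite /exp_coeff/=.
have -> : x ^+ k * (x ^+ i / i`!%:R) = x ^+ (i + k) / i`!%:R.
  by rewrite exprD mulrA (mulrC (x ^+ k)).
rewrite ler_wpM2l ?exprn_ge0// lef_pV2 ?posrE ?ltr0n ?fact_gt0//.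
by rewrite ler_nat leq_fact// leq_addr.
Unshelve. all: by end_near.
Qed.

Section poisson.
Variables (R : realType) (dE : measure_display) (E : measurableType dE).
Variables (dT : measure_display) (T : measurableType dT) (P : probability T R).
Variables (Lambda : {measure set E -> \bar R}) (X : T -> E -> nat).
Hypothesis PX : poisson_process P Lambda X.

Definition count_ge (B : set E) (k : nat) : set T :=
  (fun t => pcount R (X t) B) @^-1` [set y | (k%:R%:E <= y)%E].

Let mcount B : measurable B -> measurable_fun [set: T] (fun t => pcount R (X t) B).
Proof. by case: PX => + _ _ _; apply. Qed.

Lemma measurable_ge (c : \bar R) : measurable [set y : \bar R | (c <= y)%E].
Proof.
have := @emeasurable_itv R `[c, +oo[.
by congr measurable; apply/seteqP; split=> y /=; rewrite in_itv/= andbT.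
Qed.

Lemma measurable_count_ge B k : measurable B -> measurable (count_ge B k).
Proof.
move=> mB; rewrite -[count_ge _ _]setTI; apply: mcount => //; exact: measurable_ge.
Qed.

(** The values below k have explicit probabilities, so the tail is at most 1 minus their sum, and
    [expR_le_taylor] multiplied by e^(- l) bounds this by l^k. *)
Lemma poisson_tail (B : set E) (k : nat) : measurable B -> (Lambda B < +oo)%E ->
  (P (count_ge B k) <= (fine (Lambda B) ^+ k)%:E)%E.
Proof.
move=> mB fB; set l := fine (Lambda B).
have l0 : 0 <= l by exact: fine_ge0.
(* The last index k carries the tail event. *)
pose A (j : 'I_k.+1) : set T := if (j < k)%N then [set t | pcount R (X t) B = j%:R%:E]
  else count_ge B k.
have mA j : measurable (A j).
  rewrite /A; case: ifP => _; last exact: measurable_count_ge.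
  rewrite (_ : [set _ | _] = [set: T] `&` (fun t => pcount R (X t) B) @^-1` [set j%:R%:E]).
    by apply: mcount => //; exact: emeasurable_set1.
  by rewrite setTI.
have At : trivIset setT A.
  have le_case (i j : 'I_k.+1) : (i <= j)%N -> A i `&` A j !=set0 -> i = j.
    rewrite leq_eqVlt => /orP[/eqP/val_inj//|ij] [t []].
    have ik : (i < k)%N by rewrite (leq_trans ij)// -ltnS.
    rewrite /A ik /=; case: ifP => jk /= ti.
      by rewrite ti => -[/eqP]; rewrite eqr_nat => /eqP/val_inj.
    by rewrite /count_ge/= ti lee_fin ler_nat leqNgt ik.
  move=> i j _ _ ij; have [|/ltnW] := leqP i j; first by move/le_case; exact.
  by rewrite setIC in ij; move=> /le_case/(_ ij).
have : (\sum_j P (A j) <= 1)%E.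
  by rewrite -(probability_setT P); exact: sum_measure_trivIset_le.
rewrite big_ord_recr/= {2}/A/= ltnn.
under eq_bigr do rewrite /A /= ltn_ord; rewrite /=.
have -> : (\sum_(i < k) P [set t | pcount R (X t) B = i%:R%:E] =
  (expR (- l) * \sum_(i < k) l ^+ i / i`!%:R)%:E)%E.
  rewrite mulr_sumr -sumEFin; apply: eq_bigr => i _.
  by case: PX => _ + _ _ => ->//; rewrite mulrA.
move=> H; have {}H : (P (count_ge B k) <= 1 - (expR (- l) * \sum_(i < k) l ^+ i / i`!%:R)%:E)%E.
  by rewrite leeBrDr// addeC; exact: H.
apply: (le_trans H); rewrite -EFinB lee_fin lerBlDr.
have := ler_wpM2l (expR_ge0 (- l)) (expR_le_taylor k l0).
by rewrite mulrDr mulrCA -expRD addNr expR0 mulr1.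
Qed.

(* A bound on the outer measure: the events below need not be measurable. *)
Definition outer_le (S : set T) (c : R) : Prop :=
  exists A : set T, [/\ measurable A, S `<=` A & (P A <= c%:E)%E].

(** The sets may overlap or coincide; injectivity of [L] is what makes a product bound possible. *)
Definition distinct_points (Es : seq (set E)) : set T :=
  [set t | exists L : 'I_(size Es) -> E, injective L /\
    forall i : 'I_(size Es), nth set0 Es i (L i) /\ X t (L i) != 0%N].

Section distinct_points.
Variables (Es : seq (set E)).
Hypothesis mEs : forall i : 'I_(size Es), measurable (nth set0 Es i).
Hypothesis fEs : forall i : 'I_(size Es), (Lambda (nth set0 Es i) < +oo)%E.
Let m := size Es.

Let atom (S : {set 'I_m}) : set E :=
  [set x | forall i : 'I_m, (x \in nth set0 Es i) = (i \in S)].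

Let m_atom (S : {set 'I_m}) : measurable (atom S).
Proof.
have -> : atom S = \bigcap_(i in [set: 'I_m])
    (if i \in S then nth set0 Es i else ~` nth set0 Es i).
  apply/seteqP; split=> x xS i.
    move=> _; have := xS i; case: ifP => _; first by move/set_mem.
    by move=> /negbT/negP h xi; apply: h; rewrite inE.
  have := xS i I; case: ifP => _; first by move=> h; apply/mem_set.
  by move=> h; apply/negbTE/negP => /set_mem.
apply: fin_bigcap_measurable => // i _; case: ifP => _; first exact: mEs.
by apply: measurableC; exact: mEs.
Qed.

Let atom_sub (S : {set 'I_m}) (i : 'I_m) : i \in S -> atom S `<=` nth set0 Es i.
Proof. by move=> iS x /(_ i); rewrite iS => /set_mem. Qed.

Let atom_disj : trivIset setT atom.
Proof.
move=> S S' _ _ [x [xS xS']]; apply/setP => i; by rewrite -xS -xS'.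
Qed.

Let lam (S : {set 'I_m}) := fine (Lambda (atom S)).

Let lam_fin (S : {set 'I_m}) (i : 'I_m) : i \in S -> (Lambda (atom S) < +oo)%E.
Proof.
move=> iS; apply: le_lt_trans (fEs i).
by apply: le_measure; rewrite ?inE; [exact: m_atom|exact: mEs|exact: atom_sub].
Qed.

Let sum_lam (i : 'I_m) :
  \sum_(S : {set 'I_m} | i \in S) lam S <= fine (Lambda (nth set0 Es i)).
Proof.
rewrite -lee_fin fineK; last by rewrite ge0_fin_numE//; exact: fEs.
pose A (S : {set 'I_m}) := if i \in S then atom S else set0.
have := @sum_measure_trivIset_le _ _ _ Lambda _ A (nth set0 Es i).
have -> : (\sum_S Lambda (A S) = (\sum_(S : {set 'I_m} | i \in S) lam S)%:E)%E.
  rewrite -sumEFin [RHS]big_mkcond/=; apply: eq_bigr => S _.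
  rewrite /A; case: ifP => iS; last exact: measure0.
  by rewrite fineK// ge0_fin_numE//; exact: lam_fin iS.
apply; rewrite /A.
- by move=> S; case: ifP => _; [exact: m_atom|exact: measurable0].
- exact: mEs.
- move=> S S' _ _; case: ifP => _; case: ifP => _; rewrite ?set0I ?setI0//; try by move=> /set0P/eqP.
  exact: atom_disj.
- by move=> S; case: ifP => [/atom_sub|_ ?].
Qed.

Let cnt (f : {ffun 'I_m -> {set 'I_m}}) (S : {set 'I_m}) : nat :=
  #|[pred i | f i == S]|.

Let G (f : {ffun 'I_m -> {set 'I_m}}) : set T :=
  \bigcap_(j in [set: 'I_(#|{set 'I_m}|)])
    count_ge (atom (enum_val j)) (cnt f (enum_val j)).

(** The atoms are disjoint, so their counts are independent. Each factor is a Poisson tail, and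
    grouping the indices i by [f i] turns the product over atoms into one over i. *)
Let PG f : f \in family (fun i : 'I_m => [pred S : {set 'I_m} | i \in S]) ->
  (P (G f) <= (\prod_i lam (f i))%:E)%E.
Proof.
move=> /familyP ff.
case: PX => _ _ _ /(_ _ (fun j : 'I_(#|{set 'I_m}|) => atom (enum_val j))).
move=> /(_ (fun j => m_atom _)) indep.
have tr : trivIset [set: 'I_(#|{set 'I_m}|)] (fun j => atom (enum_val j)).
  by move=> j j' _ _ /(atom_disj I I)/enum_val_inj.
have := indep tr (fun j => [set y | ((cnt f (enum_val j))%:R%:E <= y)%E]) (fun j => measurable_ge _).
rewrite /G /count_ge => ->.
have -> : \prod_i lam (f i) = \prod_(j < #|{set 'I_m}|) lam (enum_val j) ^+ cnt f (enum_val j).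
  rewrite -(big_enum_val (fun S : {set 'I_m} => lam S ^+ cnt f S))/=.
  rewrite (partition_big f predT)//=; apply: eq_bigr => S _.
  rewrite /cnt -prodr_const; by apply: eq_big => [i|i /eqP->].
have Pfin (j : 'I_(#|{set 'I_m}|)) : P (count_ge (atom (enum_val j)) (cnt f (enum_val j))) \is a fin_num.
  by apply: fin_num_measure; exact: measurable_count_ge.
under eq_bigr do rewrite -(fineK (Pfin _)).
rewrite prodEFin lee_fin; apply: ler_prod => j _; apply/andP; split; first exact: fine_ge0.
rewrite -lee_fin fineK//.
(* An atom receiving no representative may have infinite intensity; there the bound is the trivial
   1. *)
have [|] := posnP (cnt f (enum_val j)).
  move=> ->; rewrite expr0; apply: probability_le1; exact: (measurable_count_ge 0 (m_atom _)).
move=> /card_gt0P[i]; rewrite inE => /eqP fi.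
apply: poisson_tail; first exact: m_atom.
by rewrite -fi; apply: (@lam_fin _ i); exact: ff.
Qed.

(* Distribute the representatives over the atoms of the algebra generated by
   Es: an atom receiving k of them has at least k points, which has probability
   at most its intensity to the k, independently of the other atoms. *)
Lemma distinct_points_bound :
  outer_le (distinct_points Es) (\prod_(i < m) fine (Lambda (nth set0 Es i))).
Proof.
exists (\big[setU/set0]_(f <- enum (family (fun i : 'I_m => [pred S : {set 'I_m} | i \in S]))) G f).
have mG f : measurable (G f).
  by apply: fin_bigcap_measurable => // j _; exact: measurable_count_ge.
split.
- by apply: bigsetU_measurable => f _; exact: mG.
- move=> t [L [Linj HL]]; rewrite -bigcup_seq.
  pose f := [ffun i : 'I_m => finset (fun j : 'I_m => L i \in nth set0 Es j)].
  exists f => /=.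
    rewrite mem_enum; apply/familyP => i; rewrite ffunE inE/= inE.
    by apply/mem_set; case: (HL i).
  move=> j _; rewrite /count_ge/= /cnt cardE -(size_map L).
  apply: pcount_ge_size; first by rewrite map_inj_uniq// enum_uniq.
  move=> _ /mapP[i + ->]; rewrite mem_enum inE => /eqP fi.
  split; last by case: (HL i).
  by move=> k; rewrite -fi ffunE inE.
- apply: le_trans (measure_seqU_le P _ mG) _.
  rewrite big_enum/=; apply: le_trans (lee_sum _ PG) _.
  rewrite sumEFin lee_fin -(bigA_distr_big_dep (fun i => [pred S : {set 'I_m} | i \in S]) (fun _ S => lam S))/=.
  apply: ler_prod => i _; rewrite sum_lam andbT.
  by apply: sumr_ge0 => S _; exact: fine_ge0.
Qed.

End distinct_points.
End poisson.

(** * Chains of cylinders *)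

Section outer_bounds.
Variables (R : realType) (dT : measure_display) (T : measurableType dT).
Variable P : probability T R.

Lemma outer_le_sub (S S' : set T) (c : R) :
  S `<=` S' -> outer_le P S' c -> outer_le P S c.
Proof. by move=> SS' [A [mA SA PA]]; exists A; split=> //; exact: subset_trans SA. Qed.

Lemma outer_le_trans (S : set T) (c c' : R) :
  c <= c' -> outer_le P S c -> outer_le P S c'.
Proof.
by move=> cc' [A [mA SA PA]]; exists A; split=> //; rewrite (le_trans PA)// lee_fin.
Qed.

Lemma outer_leU (S S' : set T) (c c' : R) :
  outer_le P S c -> outer_le P S' c' -> outer_le P (S `|` S') (c + c').
Proof.
move=> [A [mA SA PA]] [A' [mA' SA' PA']]; exists (A `|` A'); split.
- exact: measurableU.
- exact: setUSS.
- by rewrite (le_trans (measureU2 _ _ _))// EFinD leeD.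
Qed.

Lemma outer_le_bigcup (I : eqType) (D : set I) (S : I -> set T) (a : I -> R) (c : R) :
  countable D -> (forall i, D i -> outer_le P (S i) (a i)) ->
  (forall s : seq I, uniq s -> (forall i, i \in s -> D i) -> \sum_(i <- s) a i <= c) ->
  outer_le P (\bigcup_(i in D) S i) c.
Proof.
move=> /countable_injP[f finj] Sa ac.
have /choice[A HA] : forall i, exists A : set T, measurable A /\
    (D i -> S i `<=` A /\ (P A <= (a i)%:E)%E).
  move=> i; have [/Sa[A [mA SA PA]]|nD] := pselect (D i); first by exists A.
  by exists set0.
(* [g] is the partial inverse of the injection [f]; the partial sums of the resulting series run
   over duplicate-free lists in D, where the hypothesis applies. *)
have /choice[g Hg] : forall k, exists o : option I,
    match o with Some i => D i /\ f i = k | None => ~ exists2 i, D i & f i = k end.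
  move=> k; have [[i Di fi]|h] := pselect (exists2 i, D i & f i = k).
    by exists (Some i).
  by exists None.
pose F k := if g k is Some i then A i else set0.
have mF k : measurable (F k).
  by rewrite /F; case: (g k) => [i|]; [exact: (HA i).1|exact: measurable0].
exists (\bigcup_k F k); split.
- exact: bigcupT_measurable.
- move=> t [i Di Sit]; exists (f i) => //; rewrite /F.
  have := Hg (f i); case: (g (f i)) => [j [Dj fji]|[]]; last by exists i.
  have -> : j = i by apply: finj => //; rewrite inE.
  by apply: ((HA i).2 Di).1.
- apply: le_trans (measure_sigma_subadditive P mF _ (@subset_refl _ _)) _.
    exact: bigcupT_measurable.
  apply: lime_le; first exact: is_cvg_nneseries.
  near=> k; rewrite /=.
  have gf : ocancel g f.
    by move=> j; have := Hg j; case: (g j) => [i [_]|].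
  have le_pmap l : (\sum_(j <- l) P (F j) <= (\sum_(i <- pmap g l) a i)%:E)%E.
    elim: l => [|j l ih]; first by rewrite !big_nil.
    rewrite big_cons /= /F; have := Hg j; case: (g j) => [i [Di _]|_] /=.
      by rewrite big_cons EFinD leeD//; exact: ((HA i).2 Di).2.
    by rewrite measure0 add0e.
  apply: le_trans (le_pmap _) _; rewrite lee_fin; apply: ac.
    by apply: (pmap_uniq gf); exact: iota_uniq.
  move=> i; rewrite mem_pmap => /mapP[j _ gj].
  by have := Hg j; rewrite -gj => -[].
Unshelve. all: by end_near.
Qed.

End outer_bounds.

Section chains.
Variables (R : realType) (n : nat) (o : hyp R n.+2).
Variable mu : {measure set (line R n.+2) -> \bar R}.
Hypothesis hmu : invariant_line_measure o mu.
Variables (u : R) (hu : 0 < u).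
Variables (dT : measure_display) (T : measurableType dT) (P : probability T R).
Variable omega : T -> line R n.+2 -> nat.
Let Lambda : {measure set (line R n.+2) -> \bar R} := mscale (NngNum (ltW hu)) mu.
Hypothesis homega : poisson_process P Lambda omega.
Variables (N : set (hyp R n.+2)) (netN : is_net N).
Variables (rho : R) (rho0 : 0 <= rho).
Implicit Types (x y z : hyp R n.+2) (Es : seq (set (line R n.+2))).

Let pair_hit y z := hit y rho `&` hit z rho.

(* The points of the process contain distinct representatives of [Es] and of a
   sequence of pair_hit's joining y to x through m intermediate net points. *)
Fixpoint chained Es y x (m : nat) : set T :=
  if m is m'.+1
  then \bigcup_(z in N) chained (rcons Es (pair_hit y z)) z x m'
  else distinct_points omega (rcons Es (pair_hit y x)).

Let good Es := forall i, (i < size Es)%N ->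
  measurable (nth set0 Es i) /\ (Lambda (nth set0 Es i) < +oo)%E.

Let LambdaE y z : Lambda (pair_hit y z) = (u * mass2 mu rho y z)%:E.
Proof. by rewrite EFinM -(mass2E hmu). Qed.

Let good_rcons Es y z : good Es -> good (rcons Es (pair_hit y z)).
Proof.
move=> gE i; rewrite size_rcons nth_rcons ltnS leq_eqVlt.
case: ltngtP => // iE _; first exact: gE.
by split; [exact: measurable_hit2|rewrite LambdaE ltry].
Qed.

Let prodL Es : R := \prod_(B <- Es) fine (Lambda B).

Let prodL_ge0 Es : 0 <= prodL Es.
Proof. by apply: prodr_ge0 => B _; exact: fine_ge0. Qed.

Let prodL_rcons Es y z :
  prodL (rcons Es (pair_hit y z)) = prodL Es * (u * mass2 mu rho y z).
Proof. by rewrite /prodL big_rcons/= LambdaE. Qed.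

(** Each intermediate net point is summed out by one use of [net_sum_step], which divides the
    exponent by 4, starting from 1. Quantifying over [Es] lets the induction append the set just
    passed. *)
Lemma chained_bound (m : nat) : exists C a : R, [/\ 0 <= C, 0 < a <= 1 &
  forall Es y x, good Es ->
  outer_le P (chained Es y x m) (prodL Es * (C * expR (- (a * dH x y))))].
Proof.
elim: m => [|m [C [a [C0 /andP[a0 a1] IH]]]].
  have [C C0 HC] := mu_hit2_le_exp hmu rho0 rho0.
  exists (u * C), 1; split; [exact/mulr_ge0/C0/ltW|by rewrite ltr01 lexx|].
  move=> Es y x gE /=.
  have := @distinct_points_bound _ _ _ _ _ _ _ _ homega (rcons Es (pair_hit y x)).
  move=> /(_ _ _)/outer_le_trans; apply; last 2 first.
  - by move=> i; have [] := @good_rcons Es y x gE i (ltn_ord i).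
  - by move=> i; have [] := @good_rcons Es y x gE i (ltn_ord i).
  rewrite -(big_mkord predT (fun i => fine (Lambda (nth set0 (rcons Es (pair_hit y x)) i)))).
  rewrite -(big_nth set0 predT (fun B => fine (Lambda B))) -/(prodL _) prodL_rcons.
  rewrite ler_wpM2l// -mulrA ler_wpM2l ?(ltW hu)//.
  have h01 : 0 <= (1 : R) <= 1 by rewrite ler01 lexx.
  have := HC 1 x y 0 h01 (lexx 0).
  by rewrite add0r (mass2E hmu) lee_fin mulr0 add0r !mul1r.
have [D D0 HD] := net_sum_step hmu rho0 (introT andP (conj a0 a1)).
exists (u * C * D), (a / 4); split; [|by apply/andP; split; lra|].
  by rewrite !mulr_ge0// ltW.
move=> Es y x gE /=; case: netN => Nsep _ Ncount.
apply: (outer_le_bigcup Ncount) => [z Nz|s us sN].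
  by apply: IH; exact: good_rcons.
under eq_bigr do rewrite prodL_rcons -!mulrA.
rewrite -mulr_sumr ler_wpM2l//.
under eq_bigr do rewrite [mass2 _ _ _ _ * _]mulrCA.
rewrite -!mulr_sumr -!mulrA ler_wpM2l ?(ltW hu)// ler_wpM2l//.
rewrite (mulrA a); apply: HD => // v w /= /sN Nv /sN Nw; exact: Nsep.
Qed.

End chains.

Section intersection_graph.
Variables (T : topologicalType) (I : choiceType) (F : I -> set T).

Definition touching : rel I := fun i j => `[< F i `&` F j !=set0 >].

(** The sets reachable from a and the remaining ones have disjoint unions, both closed because s is
    finite, so connectedness leaves only the reachable ones. Shortening the path makes its vertices
    distinct. *)
Lemma connected_bigcup_path (s : seq I) (a b : I) :
  (forall i, i \in s -> closed (F i)) -> (forall i, F i !=set0) ->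
  a \in s -> b \in s -> connected (\bigcup_(i in [set` s]) F i) ->
  exists p, [/\ path touching a p, last a p = b, uniq (a :: p) & {subset p <= s}].
Proof.
move=> cF F0 sa sb; set W := \bigcup_(i in _) _ => cW.
pose A := [set i | exists p, [/\ path touching a p, last a p = i & {subset p <= s}]].
have Aa : A a by exists [::].
have Astep i j : A i -> j \in s -> F i `&` F j !=set0 -> A j.
  move=> [p [ep pi ps]] sj ij; exists (rcons p j); split.
  - by rewrite rcons_path ep pi; apply/asboolP.
  - by rewrite last_rcons.
  - by move=> k; rewrite mem_rcons inE => /orP[/eqP->//|/ps].
pose U := \bigcup_(i in [set i | i \in s /\ A i]) F i.
pose V := \bigcup_(i in [set i | i \in s /\ ~ A i]) F i.
have UW : U `<=` W by move=> t [i [si _] Fi]; exists i.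
have closed_sub (D : set I) : closed (\bigcup_(i in [set i | i \in s /\ D i]) F i).
  apply: closed_bigcup => [|i [/cF]//].
  by apply: (sub_finite_set _ (finite_seq s)) => i [].
have UWE : U = W.
  apply: cW.
  - by have [t Ft] := F0 a; exists t, a.
  - exists (~` V); first by rewrite openC; exact: (closed_sub (~` A)).
    apply/seteqP; split=> t.
      move=> Ut; split; first exact: UW.
      move: Ut => [i [si Ai] Fi] [j [sj nAj] Fj]; apply: nAj.
      by apply: (Astep i) => //; exists t.
    move=> [[i si Fi] nV]; exists i => //; split=> //.
    by apply: contrapT => nA; apply: nV; exists i.
  - exists U; first exact: (closed_sub A).
    by rewrite setIC; apply/esym/setIidPl.
have [t Ft] := F0 b.
have [i [si Ai] Fi] : U t by rewrite UWE; exists b.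
have [p [ep <- ps]] : A b by apply: (Astep i) => //; exists t.
case/shortenP: ep => p' ep' up' sub; exists p'; split=> // j /sub; exact: ps.
Qed.

End intersection_graph.

Section chains_of_cylinders.
Variables (R : realType) (n : nat) (dT : measure_display) (T : measurableType dT).
Variable omega : T -> line R n.+2 -> nat.
Variables (N : set (hyp R n.+2)) (netN : is_net N).
Variables (rho : R) (rho3 : 3 <= rho).

Lemma cylinder_hit (L : line R n.+2) x z : cylinder L x -> dH x z <= 1 -> hit z rho L.
Proof.
move=> Lx xz.
(* The distance to a line is an infimum, so a point of the line is taken at distance below 2; this
   is where 3 = 1 + 2 comes from. *)
have [y Ly xy] : exists2 y, line_set L y & dH x y < 2.
  by apply: dH_set_lt; apply: le_lt_trans Lx _; rewrite ltr1n.
exists y; split=> //; rewrite /hball/=.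
apply: le_trans rho3; apply: (le_trans (dH_triangle x z y)).
by rewrite (_ : 3 = 1 + 2 :> R) ?lerD ?(ltW xy)// 1?dHC//; ring.
Qed.

(** Invariant of the walk: [Ls] are the lines already passed, one for each set of [Es], and the
    current L hits the ball about y. A point common to the cylinders of L and of its successor is
    rounded to a net point z, which places L in E(y, z) and the successor at z. *)
Lemma chained_path (t : T) x (p : seq (line R n.+2)) : forall (L : line R n.+2) Es
    (Ls : seq (line R n.+2)) y,
  size Ls = size Es -> uniq (Ls ++ L :: p) ->
  (forall K, K \in Ls ++ L :: p -> omega t K != 0%N) ->
  (forall i, (i < size Es)%N -> nth set0 Es i (nth L Ls i)) ->
  hit y rho L -> path (touching (@cylinder R n.+2)) L p -> hit x rho (last L p) ->
  chained omega N rho Es y x (size p) t.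
Proof.
elim: p => [|L' p IH] L Es Ls y sz uLs w EsLs yL.
  move=> _ xL /=.
  exists (fun i => nth L (rcons Ls L) i); split.
    have sz' : size (rcons Ls L) = size (rcons Es (hit y rho `&` hit x rho)).
      by rewrite !size_rcons sz.
    by move=> i j /eqP; rewrite nth_uniq ?sz' ?ltn_ord// -?cats1// => /eqP/val_inj.
  case=> i ilt /=; have si := ilt; rewrite size_rcons -sz in si.
  split; last by apply: w; rewrite cats1 mem_nth// size_rcons.
  rewrite !nth_rcons sz; case: ltngtP => [iE|iE|iE].
  - exact: EsLs.
  - by move: si; rewrite ltnS leqNgt sz iE.
  - by split.
rewrite /= => /andP[/asboolP[v [Lv L'v]] pL'] xp.
have [z Nz vz] : exists2 z, N z & dH v z <= 1 by case: netN.
exists z => //; apply: (IH L' _ (rcons Ls L)) => //.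
- by rewrite !size_rcons sz.
- by rewrite cat_rcons.
- by rewrite cat_rcons.
- move=> i; rewrite size_rcons ltnS => iE.
  rewrite !nth_rcons sz; case: ltngtP => [iE'|iE'|iE'].
  + by rewrite (set_nth_default L)// ?sz//; exact: EsLs.
  + by move: iE; rewrite leqNgt iE'.
  + by split=> //; exact: cylinder_hit Lv vz.
- exact: cylinder_hit L'v vz.
Qed.

End chains_of_cylinders.

(** Intersect measurable covers of probability at most 1/(k + 1). *)
Lemma outer_le_negligible (R : realType) (dT : measure_display)
    (T : measurableType dT) (P : probability T R) (S : set T) :
  (forall e : R, 0 < e -> outer_le P S e) -> P.-negligible S.
Proof.
move=> H; have /choice[A HA] : forall k : nat, exists A : set T,
    [/\ measurable A, S `<=` A & (P A <= (k.+1%:R^-1)%:E)%E].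
  by move=> k; apply: H; rewrite invr_gt0.
have mA : measurable (\bigcap_k A k) by apply: bigcapT_measurable => k; case: (HA k).
exists (\bigcap_k A k); split=> //; last by move=> t St k _; case: (HA k) => _ + _; exact.
apply: le_anti; rewrite measure_ge0 andbT; apply/lee_addgt0Pr => e e0; rewrite add0e.
pose k := Num.trunc e^-1; have [mk _ Pk] := HA k.
apply: (@le_trans _ _ (P (A k))).
  by apply: le_measure; rewrite ?inE//; exact: bigcap_inf.
apply: (le_trans Pk); rewrite lee_fin invf_ple ?posrE//.
exact/ltW/truncnS_gt.
Qed.

(** * From the diameter to chains of distinct cylinders *)

Section diameter.
Variables (R : realType) (n : nat) (w : line R n.+2 -> nat).

(** Some m <= k cylinders connect the two, and a path without repetition among these m + 2 has at
    most m + 1 vertices after [La]. *)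
Lemma Cdist_path (La Lb : line R n.+2) (k : nat) : w La != 0%N -> w Lb != 0%N ->
  (Cdist w (cylinder La) (cylinder Lb) <= k%:R%:E)%E ->
  exists p, [/\ path (touching (@cylinder R n.+2)) La p, last La p = Lb,
    uniq (La :: p), forall L, L \in La :: p -> w L != 0%N & (size p < k.+2)%N].
Proof.
move=> wa wb ck.
(* The strict inequality yields an element of the set below its infimum bound; being an integer
   below k + 1, it is at most k. *)
have : (Cdist w (cylinder La) (cylinder Lb) < k.+1%:R%:E)%E.
  by apply: le_lt_trans ck _; rewrite lte_fin ltr_nat.
move=> /ereal_inf_lt[_ [m [c wc conn] <-]]; rewrite lte_fin ltr_nat ltnS => mk.
have /choice[L HL] : forall i, exists L : line R n.+2, w L != 0%N /\ cylinder L = c i.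
  by move=> i; have [L wL Lc] := wc i; exists L.
pose s := La :: Lb :: [seq L i | i <- enum 'I_m].
have sE : \bigcup_(K in [set` s]) cylinder K = cylinder La `|` cylinder Lb `|` \bigcup_i c i.
  apply/seteqP; split=> x.
    move=> [K /=]; rewrite !inE => /or3P[/eqP->|/eqP->|/mapP[i _ ->]] Kx.
    - by left; left.
    - by left; right.
    - by right; exists i => //; rewrite -(HL i).2.
  move=> [[Kx|Kx]|[i _ ci]].
  - by exists La => //=; rewrite inE eqxx.
  - by exists Lb => //=; rewrite !inE eqxx orbT.
  - exists (L i); last by rewrite (HL i).2.
    by rewrite /= !inE (map_f L) ?mem_enum// !orbT.
have [] := @connected_bigcup_path _ _ (@cylinder R n.+2) s La Lb.
- by move=> K _; exact: closed_cylinder.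
- move=> K; have [x Kx] := line_nonempty K; exists x.
  by rewrite /cylinder/= (le_trans (dH_set_le_point _ Kx))// dHxx.
- by rewrite inE eqxx.
- by rewrite !inE eqxx orbT.
- by rewrite sE.
move=> p [ep pb up ps]; exists p; split=> //.
  move=> K; rewrite inE => /orP[/eqP->//|/ps].
  by rewrite !inE => /or3P[/eqP->|/eqP->|/mapP[i _ ->]]//; exact: (HL i).1.
have : {subset La :: p <= s}.
  by move=> K; rewrite inE => /orP[/eqP->|/ps//]; rewrite inE eqxx.
move=> /(uniq_leq_size up); rewrite /= size_map size_enum_ord !ltnS => /leq_trans; exact.
Qed.

End diameter.

(* The dimension of the hyperbolic space is n.+2. *)
Theorem theorem1p2 (R : realType) (n : nat) (o : hyp R n.+2)
    (mu : {measure set (line R n.+2) -> \bar R})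
    (hmu : invariant_line_measure o mu)
    (u : R) (hu : 0 < u)
    (dT : measure_display) (T : measurableType dT) (P : probability T R)
    (omega : T -> line R n.+2 -> nat)
    (homega : poisson_line_process P (mscale (NngNum (ltW hu)) mu) omega) :
  {ae P, forall t, diam (omega t) = +oo%E}.
Proof.
pose Lambda : {measure set (line R n.+2) -> \bar R} := mscale (NngNum (ltW hu)) mu.
have [_ hpoisson] : _ /\ poisson_process P Lambda omega := homega.
have [N netN] := exists_net R n.+2.
suff bad k : P.-negligible [set t | (diam (omega t) <= k%:R%:E)%E].
  apply: negligibleS (negligible_bigcup bad) => t /=.
  (* The value -oo, which [diam] takes when the process has no points, is among the bad ones. *)
  case dt : (diam (omega t)) => [r| |]// _; last by exists 0%N; rewrite //= dt leNye.
  by exists (Num.trunc r).+1; rewrite //= dt lee_fin; exact/ltW/truncnS_gt.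
apply: outer_le_negligible => e e0.
(* The intensity of the lines hitting a ball is then at least 4/e, so the ball is missed with
   probability at most e^(- 4/e) <= e/4. *)
have [rho rho3 murho] := mu_hit_unbounded hmu (4 / (e * u)).
have rho0 : 0 <= rho by apply: le_trans rho3.
pose empty x := [set t | pcount R (omega t) (hit x rho) = 0%E].
have empty_le x : outer_le P (empty x) (e / 4).
  exists (empty x); split=> //.
    have [mc _ _ _] := hpoisson.
    rewrite (_ : empty x = [set: T] `&` (fun t => pcount R (omega t) (hit x rho)) @^-1` [set 0%E]).
      by apply: (mc _ (measurable_hit x rho)) => //; exact: emeasurable_set1.
    by rewrite setTI.
  have [_ pois _ _] := hpoisson.
  have mux : mu (hit x rho) = (fine (mu (hit x rho)))%:E.
    by rewrite fineK// ge0_fin_numE//; exact: (mu_hit_fin hmu).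
  have muE : Lambda (hit x rho) = (u * fine (mu (hit x rho)))%:E.
    by rewrite EFinM -mux.
  rewrite -[empty x]/[set t | pcount R (omega t) (hit x rho) = 0%:R%:E].
  rewrite (pois _ (measurable_hit x rho)); last first.
    by rewrite muE ltry.
  rewrite expr0 mulr1 divr1 lee_fin expRN.
  rewrite muE/=.
  have h : 4 / e <= u * fine (mu (hit x rho)).
    move: murho; rewrite (mu_hit_eq hmu o x) mux lee_fin => /(ler_wpM2l (ltW hu)).
    by rewrite (_ : u * (4 / (e * u)) = 4 / e)//; field; rewrite !gt_eqF.
  rewrite invf_ple ?posrE ?expR_gt0 ?divr_gt0// invf_div.
  by apply: le_trans h _; apply: le_trans (expR_ge1Dx _); rewrite lerDr.
have chained_small K (e' : R) : 0 < e' -> exists r0 : R, forall x y, r0 <= dH x y ->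
    outer_le P (\bigcup_(m in [set m | (m < K)%N]) chained omega N rho [::] y x m) e'.
  elim: K e' => [|K IH] e' e'0.
    exists 0 => x y _; exists set0; split; [by []|by move=> t []|].
    by rewrite measure0; have := ltW e'0; rewrite -lee_fin; exact.
  have e'2 : 0 < e' / 2 by rewrite divr_gt0.
  have [r0 Hr0] := IH _ e'2.
  have [C [a [C0 /andP[a0 _] HC]]] := chained_bound hmu hpoisson netN rho0 K.
  exists (Num.max r0 (2 * C / (a * e'))) => x y; rewrite ge_max => /andP[r0x r1x].
  apply: (@outer_le_sub _ _ _ _ _ (\bigcup_(m in [set m | (m < K)%N])
      chained omega N rho [::] y x m `|` chained omega N rho [::] y x K)).
    move=> t [m /=]; rewrite ltnS leq_eqVlt => /orP[/eqP->|mK] tm; first by right.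
    by left; exists m.
  rewrite [e'](_ : _ = e' / 2 + e' / 2); last by field.
  apply: outer_leU; first exact: Hr0.
  apply: outer_le_trans (HC [::] y x _) => //.
  rewrite big_nil mul1r expRN ler_pdivrMr ?expR_gt0//.
  apply: (@le_trans _ _ (e' / 2 * (1 + a * dH x y))); last first.
    by rewrite ler_wpM2l ?expR_ge1Dx// divr_ge0// ltW.
  rewrite mulrDr mulr1 ler_wpDl ?(ltW e'2)// mulrA.
  move: r1x; rewrite ler_pdivrMr ?mulr_gt0// => r1x.
  have -> : e' / 2 * a * dH x y = dH x y * (a * e') / 2 by field.
  by rewrite ler_pdivlMr// mulrC.
have e2 : 0 < e / 2 by rewrite divr_gt0.
have [r0 Hr0] := chained_small k.+2 _ e2.
have [x ox] := exists_far o (normr_ge0 r0).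
have r0x : r0 <= dH x o by rewrite dHC ox ler_norm.
(* If both balls are hit, lines La and Lb through them have [Cdist] at most k, and [Cdist_path]
   gives a chain with fewer than k + 2 net points. *)
apply: (@outer_le_sub _ _ _ _ _ (empty o `|` empty x `|`
  \bigcup_(m in [set m | (m < k.+2)%N]) chained omega N rho [::] o x m)).
  move=> t dk.
  have [e1|/pcount_neq0[La oLa wLa]] := eqVneq (pcount R (omega t) (hit o rho)) 0%E.
    by left; left.
  have [e1|/pcount_neq0[Lb xLb wLb]] := eqVneq (pcount R (omega t) (hit x rho)) 0%E.
    by left; right.
  right.
  have [|p [ep pb up wp sp]] := @Cdist_path _ _ (omega t) La Lb k wLa wLb.
    apply: le_trans dk; apply: ereal_sup_ubound.
    by exists (cylinder La); [exists La|exists (cylinder Lb) => //; exists Lb].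
  exists (size p) => //.
  by apply: (@chained_path _ _ _ _ _ _ netN _ rho3 _ _ _ La [::] [::]) => //; rewrite pb.
have -> : e = e / 4 + e / 4 + e / 2 by field.
by apply: outer_leU; [apply: outer_leU|exact: Hr0].
Qed.
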